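(* Let $n\in\mathbb{R}^+\cup\{0\}$ and let $\mathcal{J}_a^n$ be the Riemann–Liouville fractional integral operator of order $n$ on $D_{HK}$. Then: (i) $\mathcal{J}_a^n$ maps $D_{HK}$ into $D_{HK}$; (ii) $\mathcal{J}_a^n:D_{HK}\to D_{HK}$ is a bounded linear operator with respect to the Alexiewicz norm; (iii) if $(f_k)\subset D_{HK}$ converges in the Alexiewicz norm to $f\in D_{HK}$, then $(\mathcal{J}_a^nf_k)$ converges in the Alexiewicz norm to $\mathcal{J}_a^nf$; (iv) if $n\geq 1$ and $f\in D_{HK}$, then $\mathcal{J}_a^nf(x)=\frac{1}{\Gamma(n)}\lim_{k\to\infty}\int_a^x(x-t)^{n-1}f_k(t)\,dt$, the convergence holding both in $D_{HK}$ (Alexiewicz norm) and in $C[a,b]$ (uniformly on $[a,b]$), for any sequence $(f_k)\subset L^1[a,b]$ with $\|f_k-f\|_A\to 0$.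
   Context: Fix real numbers $a<b$. $\mathcal{D}(a,b)$ is the space of real $C^\infty$ functions with compact support in $(a,b)$, $\mathcal{D}'(a,b)$ the space of distributions on $(a,b)$, $D$ the distributional derivative. Let $C_0=\{F\in C[a,b]:F(a)=0\}$. A distribution $f\in\mathcal{D}'(a,b)$ is Henstock–Kurzweil integrable if there is $F\in C_0$ with $DF=f$ (such $F$ is unique, the primitive of $f$), and its distributional Henstock–Kurzweil integral is $\int_c^d f=F(d)-F(c)$. $D_{HK}$ is the space of these distributions with the Alexiewicz norm $\|f\|_A=\sup_{x\in[a,b]}|F(x)|$; it is a Banach space containing $L^1[a,b]$ as a dense subspace, and integrals against functions of bounded variation are defined (via $\int_a^b fg=F(b)g(b)-\int_a^b F\,dg$). Riemann–Liouville fractional integral on $D_{HK}$: for $n\ge 1$, $\mathcal{J}_a^nf(x)=\frac{1}{\Gamma(n)}\int_a^x(x-t)^{n-1}f(t)\,dt$ for $a\le x\le b$ (distributional Henstock–Kurzweil integral); for $0<n<1$, $\mathcal{J}_a^nf(x)=\frac{1}{\Gamma(n)}\lim_{k\to\infty}\int_a^x(x-t)^{n-1}f_k(t)\,dt$, where $(f_k)\subset L^1[a,b]$ with $\|f_k-f\|_A\to0$ (the convolution of the $L^1$ kernel $u\mapsto u^{n-1}$ on $(0,b-a]$, $0$ elsewhere, with $f$); $\mathcal{J}_a^0$ is the identity. *)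

(* Defs.v *)
From HB Require Import structures.
From mathcomp Require Import all_boot all_order all_algebra.
From mathcomp Require Import all_classical all_reals all_analysis.
Set Implicit Arguments. Unset Strict Implicit. Unset Printing Implicit Defensive.
Import Order.TTheory GRing.Theory Num.Theory.
Import numFieldNormedType.Exports.
Local Open Scope classical_set_scope.
Local Open Scope ring_scope.

Section HK.
Variable R : realType.
Variables a b : R.
Local Notation mu := (@lebesgue_measure R).

(** Distributions on (a,b) are represented as functionals on R -> R;
    only their values on test functions matter (see [dist_eq]). *)
Definition dist := (R -> R) -> R.

Definition test_fun (phi : R -> R) : Prop :=
  (forall (k : nat) (x : R), derivable (derive1n k phi) x 1) /\
  exists c d : R, [/\ a < c, d < b & forall x, x < c \/ d < x -> phi x = 0].

Definition dist_eq (f g : dist) : Prop := forall phi, test_fun phi -> f phi = g phi.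

Definition dist_add (f g : dist) : dist := fun phi => f phi + g phi.
Definition dist_scale (c : R) (f : dist) : dist := fun phi => c * f phi.
Definition dist_sub (f g : dist) : dist := fun phi => f phi - g phi.

Definition is_prim (f : dist) (F : R -> R) : Prop :=
  [/\ {within `[a, b], continuous F}, F a = 0 &
      forall phi, test_fun phi ->
        f phi = - \int[mu]_(x in `[a, b]) (F x * derive1 phi x)].

Definition DHK (f : dist) : Prop := exists F, is_prim f F.

Definition prim (f : dist) : R -> R := xget (fun=> 0) (is_prim f).

Definition hk_int (f : dist) (c d : R) : R := prim f d - prim f c.

Definition alex (f : dist) : R := sup [set `|prim f x| | x in `[a, b]].

Definition alex_to (fs : nat -> dist) (f : dist) : Prop :=
  (fun k => alex (dist_sub (fs k) f)) @ \oo --> 0.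

Definition isL1 (g : R -> R) : Prop := mu.-integrable `[a, b] (EFin \o g).
Definition regdist (g : R -> R) : dist :=
  fun phi => \int[mu]_(x in `[a, b]) (g x * phi x).

Definition GammaF (n : R) : R :=
  \int[mu]_(t in `]0, +oo[) (t `^ (n - 1) * expR (- t)).

(** Product integral of f in D_HK against g of bounded variation on [a,c]:
    int_a^c f g = F(c) g(c) - int_a^c F dg.  The Stieltjes integral
    int F dg is written as int F g' dt (g absolutely continuous here). *)
Definition hk_int_bv (f : dist) (g : R -> R) (c : R) : R :=
  prim f c * g c - \int[mu]_(t in `[a, c]) (prim f t * derive1 g t).

Definition RLfun (n : R) (f : dist) (x : R) : R :=
  (GammaF n)^-1 * hk_int_bv f (fun t => (x - t) `^ (n - 1)) x.

Definition RLconv (n : R) (g : R -> R) (x : R) : R :=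
  (GammaF n)^-1 * \int[mu]_(t in `[a, x]) ((x - t) `^ (n - 1) * g t).

Definition is_RLfrac (n : R) (f g : dist) : Prop :=
  DHK g /\
  forall fk : nat -> R -> R, (forall k, isL1 (fk k)) ->
    alex_to (fun k => regdist (fk k)) f ->
    alex_to (fun k => regdist (RLconv n (fk k))) g.

Definition RL (n : R) (f : dist) : dist :=
  if n == 0 then f
  else if n < 1 then xget (fun=> 0) (is_RLfrac n f)
  else regdist (RLfun n f).

End HK.

(* Main.v *)
Require Import Defs.
From HB Require Import structures.
From mathcomp Require Import all_boot all_order all_algebra.
From mathcomp Require Import all_classical all_reals all_analysis.
From mathcomp Require Import measurable_realfun ring lra.
Set Implicit Arguments.
Unset Strict Implicit.
Unset Printing Implicit Defensive.
Import Order.TTheory GRing.Theory Num.Theory.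
Import numFieldNormedType.Exports.
Local Open Scope classical_set_scope.
Local Open Scope ring_scope.

(** Fix [c = 1 / Gamma(n)] and put [K_m g x = \int_a^x (x - t)^(m-1) g t dt].
    For every order [n > 0] the primitive of [J_a^n f] is [c K_n F], where [F]
    is the primitive of [f]; the four assertions then follow from the linearity
    of [K_n] and the bound [|K_n F| <= sup |F| (b - a)^n / n], whatever the value
    of [c].  Exchanging the order of integration over a triangle gives, for [g]
    in [L^1] with primitive [G], the two identities
    [\int_a^x K_m g = K_(m+1) g x / m = K_m G x].
    They settle the case of [L^1] functions, and also [n >= 1], where
    [J_a^n f = c (n - 1) K_(n-1) F].  For [0 < n < 1] (and for the continuity of
    [K_n F]) one passes to the uniform limit, the primitives of [L^1] functions
    being dense among continuous functions vanishing at [a].  Primitives are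
    unique by the lemma of du Bois-Reymond, for which smooth bump functions are
    built from [exp (- 1 / x)]. *)

(** * Integrals of power kernels *)

Section open_FTC2.
Variable R : realType.
Local Notation mu := (@lebesgue_measure R).

(** The integrand may blow up at an endpoint, so the fundamental theorem is applied on compact
    intervals exhausting []s, x[]. Monotone convergence handles the integrals, continuity of [F] the
    boundary values. *)
Lemma ge0_open_FTC2 (f F : R -> R) (s x : R) : s < x ->
  (forall t, s < t < x -> 0 <= f t) ->
  (forall t, s < t < x -> {for t, continuous f}) ->
  (forall t, s < t < x -> is_derive t 1 F (f t)) ->
  {within `[s, x], continuous F} ->
  (\int[mu]_(t in `]s, x[) (f t)%:E = (F x - F s)%:E)%E.
Proof.
move=> sx f0 cf dF cF.
(* Starting the denominators at 3 gives [h k <= (x - s) / 3], so that [s + h k < x - h k] for every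
   [k]. *)
pose h (k : nat) : R := (x - s) / (k.+3)%:R.
have h0 k : 0 < h k by rewrite divr_gt0 ?subr_gt0.
have h3 k : h k <= (x - s) / 3.
  by rewrite ler_pM2l ?subr_gt0// lef_pV2 ?posrE// ler_nat.
have hnd : {homo h : m n / (m <= n)%N >-> n <= m}.
  by move=> m n mn; rewrite ler_pM2l ?subr_gt0// lef_pV2 ?posrE// ler_nat.
have hcvg : h @ \oo --> 0.
  rewrite /h -[X in _ --> X](mulr0 (x - s)); apply: cvgMl_tmp.
  have /cvgrPdist_lt hh := @cvg_harmonic R.
  apply/cvgrPdist_lt => e e0; have := hh _ e0; apply: filterS => k.
  rewrite /= !sub0r !normrN !ger0_norm ?invr_ge0//; apply: le_lt_trans.
    by rewrite lef_pV2 ?posrE// ler_nat; exact: leqW (leqnSn _).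
pose A (k : nat) := `[s + h k, x - h k]%classic.
have Asub k : A k `<=` `]s, x[.
  move=> t; rewrite /A /= !in_itv /= => /andP[t1 t2]; have := h0 k.
  by move=> hk; apply/andP; split; lra.
have AE : \bigcup_k A k = `]s, x[%classic.
  apply/seteqP; split => [t [k _ /Asub//]|t /=]; rewrite in_itv /= => /andP[st tx].
  have d0 : 0 < Num.min (t - s) (x - t) by rewrite lt_min !subr_gt0 st tx.
  move/cvgrPdist_lt : hcvg => /(_ _ d0) [N _ /(_ N (leqnn N)) /=].
  rewrite sub0r normrN gtr0_norm// lt_min => /andP[h1 h2].
  by exists N => //; rewrite /A /= in_itv /=; apply/andP; split; lra.
have cfo : measurable_fun `]s, x[ f.
  apply: open_continuous_measurable_fun; first exact: interval_open.
  by move=> t; rewrite inE /= in_itv; exact: cf.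
have step k : (\int[mu]_(t in A k) (f t)%:E = (F (x - h k) - F (s + h k))%:E)%E.
  have cF' := continuous_within_itvP F sx.
  have [cFo cFs cFx] := cF'.1 cF.
  have sk : s + h k < x - h k by have := h3 k; have := sx; lra.
  rewrite EFinB; apply: continuous_FTC2 => //.
  - apply: continuous_in_subspaceT => t; rewrite inE => /Asub /=.
    by rewrite in_itv /=; exact: cf.
  - split.
    + move=> t; rewrite in_itv /= => /andP[t1 t2].
      by have [] : is_derive t 1 F (f t) by apply: dF; have := h0 k; lra.
    + apply: cvg_at_right_filter; apply: cFo; rewrite in_itv /=; have := h0 k.
      by lra.
    + apply: cvg_at_left_filter; apply: cFo; rewrite in_itv /=; have := h0 k.
      by lra.
  - move=> t; rewrite in_itv /= => /andP[t1 t2].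
    have : is_derive t 1 F (f t) by apply: dF; have := h0 k; lra.
    by move=> ?; rewrite derive1E derive_val.
have lim1 : (fun k => \int[mu]_(t in A k) (f t)%:E)%E @ \oo -->
    (\int[mu]_(t in `]s, x[) (f t)%:E)%E.
  rewrite -AE; apply: ge0_nondecreasing_set_cvg_integral.
  - move=> m n mn; rewrite subsetEset => t; rewrite /A /= !in_itv /=.
    by have := hnd _ _ mn; lra.
  - by move=> k; exact: measurable_itv.
  - move=> k; apply/measurable_EFinP; apply: measurable_funS cfo => //.
  - move=> k t /Asub /=; rewrite in_itv /= lee_fin; exact: f0.
have lim2 : (fun k => (F (x - h k) - F (s + h k))%:E) @ \oo --> (F x - F s)%:E.
  have [_ cFs cFx] := (continuous_within_itvP F sx).1 cF.
  apply: cvg_EFin; first by near=> k.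
  apply: cvgB.
    have /cvg_at_leftP := cFx; apply; split=> [k|]; first by have := h0 k; lra.
    by rewrite -[X in _ --> X]subr0; apply: cvgB => //; exact: cvg_cst.
  have /cvg_at_rightP := cFs; apply; split=> [k|]; first by have := h0 k; lra.
  by rewrite -[X in _ --> X]addr0; apply: cvgD => //; exact: cvg_cst.
rewrite (_ : (fun k => _) = (fun k => (F (x - h k) - F (s + h k))%:E)) in lim1.
  exact: (cvg_unique _ lim1 lim2).
by apply/funext => k; exact: step.
Unshelve. all: by end_near. Qed.

End open_FTC2.

Section power_kernel.
Variable R : realType.
Implicit Types m s x t : R.
Local Notation mu := (@lebesgue_measure R).

Lemma measurable_powR_subr (x p : R) : measurable_fun setT (fun t : R => (x - t) `^ p).
Proof.
apply: (measurableT_comp (measurable_powR p)).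
by apply: measurable_funB => //; exact: measurable_cst.
Qed.

Lemma measurable_powR_subl (s p : R) : measurable_fun setT (fun t : R => (t - s) `^ p).
Proof.
apply: (measurableT_comp (measurable_powR p)).
by apply: measurable_funB => //; exact: measurable_cst.
Qed.

Lemma is_derive_continuous (f : R -> R) (t l : R) :
  is_derive t 1 f l -> {for t, continuous f}.
Proof. by case=> df _; exact/differentiable_continuous/derivable1_diffP. Qed.

Lemma is_derive_powR_subr (m x t : R) : m != 0 -> t < x ->
  is_derive t 1 (fun u => - ((x - u) `^ m / m)) ((x - t) `^ (m - 1)).
Proof.
move=> m0 tx.
have xt : 0 < x - t by rewrite subr_gt0.
have h1 : is_derive t 1 (fun u : R => x - u) (-1).
  by apply: is_derive_eq; rewrite add0r mul1r.
have h2 := @is_derive1_comp R (@powR R ^~ m) (fun u : R => x - u) t _ _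
  (is_derive1_powR m xt) h1.
have h3 := is_deriveN (is_deriveM h2 (is_derive_cst m^-1 t 1)).
apply: is_derive_eq h3 _.
by rewrite /GRing.scale /= mulr0 add0r; field.
Qed.

Lemma is_derive_powR_subl (m s t : R) : m != 0 -> s < t ->
  is_derive t 1 (fun u => (u - s) `^ m / m) ((t - s) `^ (m - 1)).
Proof.
move=> m0 st.
have ts : 0 < t - s by rewrite subr_gt0.
have h1 : is_derive t 1 (fun u : R => u - s) 1.
  by apply: is_derive_eq; rewrite ?oppr0 ?addr0.
have h2 := @is_derive1_comp R (@powR R ^~ m) (fun u : R => u - s) t _ _
  (is_derive1_powR m ts) h1.
have h3 := is_deriveM h2 (is_derive_cst m^-1 t 1).
apply: is_derive_eq h3 _.
by rewrite /GRing.scale /= mulr0 add0r; field.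
Qed.

Lemma integral_itv_oo_cc (s x : R) (f : R -> R) : measurable_fun setT f ->
  (\int[mu]_(t in `]s, x[) (f t)%:E = \int[mu]_(t in `[s, x]) (f t)%:E)%E.
Proof.
move=> mf.
rewrite -integral_itv_obnd_cbnd; last first.
  by apply/measurable_EFinP; exact: measurable_funTS.
by rewrite -integral_itv_bndo_bndc//; apply/measurable_EFinP; exact: measurable_funTS.
Qed.

(** For [m < 1] the kernel is singular at [t = x], but its antiderivative [- (x - t)^m / m] is
    continuous up to [x] because [u^m] tends to 0 with [u]. *)
Lemma integral_powR_subr (m s x : R) : 0 < m -> s <= x ->
  (\int[mu]_(t in `[s, x]) ((x - t) `^ (m - 1))%:E = ((x - s) `^ m / m)%:E)%E.
Proof.
move=> m0; rewrite le_eqVlt => /predU1P[->|sx].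
  by rewrite set_itv1 integral_set1 subrr powR0 ?mul0r// gt_eqF.
have mN0 : m != 0 by rewrite gt_eqF.
rewrite -integral_itv_oo_cc; last exact: measurable_powR_subr.
have dF t : s < t < x -> is_derive t 1 (fun u => - ((x - u) `^ m / m)) ((x - t) `^ (m - 1)).
  by move=> /andP[st tx]; exact: is_derive_powR_subr.
have cF : {within `[s, x], continuous (fun u => - ((x - u) `^ m / m))}.
  apply: derivable_oo_LRcontinuous_within; split.
  - move=> t; rewrite in_itv /= => /andP[_ tx].
    by have [] := is_derive_powR_subr mN0 tx.
  - apply: cvg_at_right_filter; exact: (is_derive_continuous (is_derive_powR_subr mN0 sx)).
  - apply: cvgN; rewrite (_ : (x - x) `^ m / m = 0 / m); last by rewrite subrr powR0.
    apply: cvgMr_tmp; apply/cvg_at_leftP => u [ux uc].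
    have /cvg_at_rightP := powR_cvg0 m0; apply; split=> [k|]; first by rewrite subr_gt0.
    by rewrite -(subrr x); apply: cvgB => //; exact: cvg_cst.
rewrite (ge0_open_FTC2 sx _ _ dF cF) //.
- by rewrite subrr powR0// mul0r oppr0 sub0r opprK.
- by move=> t _; exact: powR_ge0.
- move=> t /andP[_ tx];   have xt : 0 < x - t by rewrite subr_gt0.
  have h1 : is_derive t 1 (fun u : R => x - u) (-1).
    by apply: is_derive_eq; rewrite add0r mul1r.
  exact: (is_derive_continuous (@is_derive1_comp R (@powR R ^~ (m - 1))
    (fun u : R => x - u) t _ _ (is_derive1_powR (m - 1) xt) h1)).
Qed.

Lemma integral_powR_subl (m s x : R) : 0 < m -> s <= x ->
  (\int[mu]_(t in `[s, x]) ((t - s) `^ (m - 1))%:E = ((x - s) `^ m / m)%:E)%E.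
Proof.
move=> m0; rewrite le_eqVlt => /predU1P[->|sx].
  by rewrite set_itv1 integral_set1 subrr powR0 ?mul0r// gt_eqF.
have mN0 : m != 0 by rewrite gt_eqF.
rewrite -integral_itv_oo_cc; last exact: measurable_powR_subl.
have dF t : s < t < x -> is_derive t 1 (fun u => (u - s) `^ m / m) ((t - s) `^ (m - 1)).
  by move=> /andP[st tx]; exact: is_derive_powR_subl.
have cF : {within `[s, x], continuous (fun u => (u - s) `^ m / m)}.
  apply: derivable_oo_LRcontinuous_within; split.
  - move=> t; rewrite in_itv /= => /andP[st _].
    by have [] := is_derive_powR_subl mN0 st.
  - rewrite (_ : (s - s) `^ m / m = 0 / m); last by rewrite subrr powR0.
    apply: cvgMr_tmp; apply/cvg_at_rightP => u [us uc].
    have /cvg_at_rightP := powR_cvg0 m0; apply; split=> [k|]; first by rewrite subr_gt0.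
    by rewrite -(subrr s); apply: cvgB => //; exact: cvg_cst.
  - apply: cvg_at_left_filter; exact: (is_derive_continuous (is_derive_powR_subl mN0 sx)).
rewrite (ge0_open_FTC2 sx _ _ dF cF) //.
- by rewrite subrr powR0// mul0r subr0.
- by move=> t _; exact: powR_ge0.
- move=> t /andP[st _];   have ts : 0 < t - s by rewrite subr_gt0.
  have h1 : is_derive t 1 (fun u : R => u - s) 1.
    by apply: is_derive_eq; rewrite ?oppr0 ?addr0.
  exact: (is_derive_continuous (@is_derive1_comp R (@powR R ^~ (m - 1))
    (fun u : R => u - s) t _ _ (is_derive1_powR (m - 1) ts) h1)).
Qed.

End power_kernel.

(** * Exchange of integrals over a triangle *)

Section integral_fine.
Context d (T : measurableType d) (R : realType).
Variable mu : {measure set T -> \bar R}.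

Lemma integrable_fine (D : set T) (f : T -> \bar R) : measurable D ->
  mu.-integrable D f -> mu.-integrable D (EFin \o (fine \o f)).
Proof.
move=> mD fi; have mf := measurable_int _ fi.
apply: (le_integrable mD _ _ fi).
  apply/measurable_EFinP; apply: (measurableT_comp _ mf).
  by move=> ? ?; exact: fine_measurable.
by move=> t _ /=; case: (f t) => [r| |] //=; rewrite ?normr0 ?lee_fin ?leey.
Qed.

(** An integrable function is finite almost everywhere, so [fine] alters it only on a null set. This
    links Fubini's theorem, stated in the extended reals, to iterated real integrals. *)
Lemma Rintegral_fine (D : set T) (f : T -> \bar R) : measurable D ->
  mu.-integrable D f ->
  \int[mu]_(x in D) fine (f x) = fine (\int[mu]_(x in D) f x)%E.
Proof.
move=> mD fi; congr fine; apply: ae_eq_integral => //.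
- exact: measurable_int (integrable_fine mD fi).
- exact: measurable_int fi.
- apply: filterS (integrable_ae mD fi) => t + Dt => /(_ Dt) ft.
  by rewrite /= fineK.
Qed.

End integral_fine.

Section triangle.
Variable R : realType.
Local Notation mu := (@lebesgue_measure R).
Local Notation T := (measurableTypeR R).

(** Extended by zero off the triangle [a <= t <= s <= x], the integrand becomes a function on the
    plane. Integrating [|k|] in [s] first leaves at most [C |g t|], so Tonelli yields integrability
    and Fubini the exchange. *)
Lemma triangle_Fubini (k : R -> R -> R) (g : R -> R) (a x C : R) :
  measurable_fun (setT : set (T * T)) (fun p => k p.1 p.2) ->
  mu.-integrable `[a, x] (EFin \o g) ->
  (forall t, a <= t <= x -> (\int[mu]_(s in `[t, x]) `|k s t|%:E <= C%:E)%E) ->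
  mu.-integrable `[a, x]
    (EFin \o (fun s => \int[mu]_(t in `[a, s]) (k s t * g t))) /\
  \int[mu]_(s in `[a, x]) (\int[mu]_(t in `[a, s]) (k s t * g t)) =
  \int[mu]_(t in `[a, x]) ((\int[mu]_(s in `[t, x]) k s t) * g t).
Proof.
move=> mk gi kC.
have mg : measurable_fun `[a, x] g by apply/measurable_EFinP; exact: measurable_int gi.
pose cut (g : R -> R) (t : R) : R := if a <= t <= x then g t else 0.
have cutE : g \_ `[a, x] = cut g.
  by apply/funext => t; rewrite patchE mem_setE in_itv.
have mgA : measurable_fun (setT : set T) (cut g).
  by rewrite -cutE; apply/(measurable_restrictT _ _).1.
(* The indicator of [t <= s <= x], factored through indicators of intervals so that its
   measurability follows by composition. *)
pose w (p : T * T) : R := \1_(`[0, +oo[%classic : set R) (p.1 - p.2) *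
  \1_(`]-oo, x]%classic : set R) p.1.
have wE (s t : R) : w (s, t) = ((t <= s) && (s <= x))%:R.
  rewrite /w !indicE /= !mem_setE !in_itv /= andbT subr_ge0.
  by case: (t <= s); case: (s <= x); rewrite ?mulr0 ?mulr1.
pose f (p : T * T) : \bar R := (k p.1 p.2 * cut g p.2 * w p)%:E.
have mf : measurable_fun setT f.
  apply/measurable_EFinP; apply: measurable_funM.
    by apply: measurable_funM => //; exact: measurableT_comp.
  apply: measurable_funM.
    apply: (measurableT_comp (measurable_indic _)) => //.
    exact: measurable_funB.
  exact: (measurableT_comp (measurable_indic _)).
have FE (s : T) : ((\int[mu]_t f (s, t)) = if (a <= s <= x)%R then
    \int[mu]_(t in `[a, s]) (k s t * g t)%:E else 0)%E.
  case: ifPn => [/andP[as_ sx]|].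
    rewrite [RHS]integral_mkcond; apply: eq_integral => t _.
    rewrite /f wE /cut /= patchE mem_setE in_itv /= sx andbT.
    have [ts|st] := leP t s; rewrite /= ?andbF ?mulr0//.
    by rewrite (le_trans ts sx) !andbT; case: ifP; rewrite ?mulr1 ?mulr0.
  rewrite negb_and -!ltNge => H.
  apply: integral0_eq => t _.
  rewrite /f wE /cut /=; congr EFin.
  have [ts|] := leP t s; rewrite /= ?mulr0//.
  have [sx|] := leP s x; rewrite /= ?mulr0//.
  case: ifP; rewrite ?mulr0 ?mul0r// => /andP[at_ _].
  by case/orP: H; rewrite ltNge ?sx// (le_trans at_ ts).
(* Stated for a general kernel: it serves once with absolute values, for the bound, and once with
   [k] and [g] themselves. *)
have GE (h : R -> R -> R) (g2 : R -> R) (t : T) :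
    ((\int[mu]_s (h s t * cut g2 t * w (s, t))%:E) = if (a <= t <= x)%R then
    \int[mu]_(s in `[t, x]) (h s t * g2 t)%:E else 0)%E.
  rewrite /cut; case: ifPn => [tax|tax].
    rewrite [RHS]integral_mkcond; apply: eq_integral => s _.
    rewrite wE patchE mem_setE in_itv /=.
    by case: ifP; rewrite ?mulr1 ?mulr0.
  by apply: integral0_eq => s _; rewrite mulr0 mul0r.
have gint : mu.-integrable setT (fun t => (C * `|cut g t|)%:E).
  have cgi : mu.-integrable setT (EFin \o cut g).
    rewrite -cutE -restrict_EFin; apply: (integrable_mkcond _ _).1 => //.
  by apply: eq_integrable (integrableZl measurableT C (integrable_norm cgi)).
have mk2 (t : R) : measurable_fun setT (fun s : R => k s t).
  exact: (measurableT_comp mk (measurable_pair2 _)).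
have fi : (mu \x mu)%E.-integrable setT f.
  apply/(@integrable21ltyP _ _ _ _ _ mu mu) => //.
  case/integrableP: gint => mgi; apply: le_lt_trans.
  apply: ge0_le_integral => //=.
  - by move=> t _; exact: integral_ge0.
  - apply: (@measurable_fun_fubini_tonelli_G _ _ _ _ _ mu (abse \o f)) => //=.
    exact: measurableT_comp.
  - by do 2 apply: measurableT_comp => //; apply/measurable_EFinP.
  move=> t _.
  rewrite (_ : (\int[mu]_s _)%E = (\int[mu]_s
      (`|k s t| * cut (fun t => `|g t|) t * w (s, t))%:E)%E); last first.
    apply: eq_integral => s _; rewrite /f /= (normrM _ (w _)) (normrM (k _ _)).
    congr (_ * _ * _)%:E.
      by rewrite /cut; case: ifP; rewrite ?normr0.
    by rewrite wE ger0_norm.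
  have -> := GE (fun s t => `|k s t|) (fun t => `|g t|) t.
  rewrite /cut; case: ifPn => tax; last first.
    by rewrite normr0 mulr0 normr0.
  under eq_integral do rewrite EFinM.
  rewrite ge0_integralZr//; last first.
    by apply/measurable_EFinP/measurableT_comp => //; exact: measurable_funTS (mk2 t).
  apply: (le_trans (lee_wpmul2r _ (kC t tax))); first by rewrite lee_fin.
  by rewrite -EFinM lee_fin ler_norm.
have kE (t : R) : a <= t <= x -> mu.-integrable `[t, x] (fun s => (k s t)%:E).
  move=> tax; apply/integrableP; split.
    by apply/measurable_EFinP; exact: measurable_funTS (mk2 t).
  by apply: le_lt_trans (kC t tax) _; rewrite ltry.
have F0i : mu.-integrable `[a, x] (fun s => \int[mu]_(t in `[a, s]) (k s t * g t)%:E)%E.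
  apply/integrable_mkcond => //.
  apply: eq_integrable (integrable_fubini_F fi) => // s _.
  by rewrite /fubini_F FE patchE mem_setE in_itv.
split; first exact: integrable_fine.
rewrite [LHS]Rintegral_fine// [in LHS]integral_mkcond.
rewrite [X in fine X](_ : _ = \int[mu]_s \int[mu]_t f (s, t))%E; last first.
  by apply: eq_integral => s _; rewrite FE patchE mem_setE in_itv.
rewrite (Fubini fi) /Rintegral; congr fine; rewrite [RHS]integral_mkcond.
apply: eq_integral => t _; rewrite (GE k) patchE mem_setE in_itv /=.
case: ifPn => // tax.
under eq_integral do rewrite EFinM.
by rewrite integralZr ?kE// EFinM fineK//; apply: integrable_fin_num => //; exact: kE.
Qed.

End triangle.

(** * Riemann-Liouville integrals of functions *)

Section fractional_kernel.
Variable R : realType.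
Implicit Types (a b m x : R) (g F : R -> R).
Local Notation mu := (@lebesgue_measure R).

(* The Riemann-Liouville integral of order [m] without the factor 1 / Gamma(m). *)
Definition frac m a g x := \int[mu]_(t in `[a, x]) ((x - t) `^ (m - 1) * g t).

Definition antider a g x := \int[mu]_(t in `[a, x]) g t.

Lemma within_continuous_integrable a b F : {within `[a, b], continuous F} ->
  mu.-integrable `[a, b] (EFin \o F).
Proof. by apply: continuous_compact_integrable; exact: segment_compact. Qed.

Lemma within_continuous_bounded a b F : {within `[a, b], continuous F} ->
  exists M : R, forall t, a <= t <= b -> `|F t| <= M.
Proof.
move=> cF.
have /compact_bounded[M [_ mrt]] := continuous_compact cF (@segment_compact _ a b).
exists (M + 1) => t tab; apply: (mrt (M + 1)); first by rewrite ltrDl.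
by exists t => //=; rewrite in_itv.
Qed.

Lemma integrable_bounded_mul a b (h g : R -> R) M : measurable_fun `[a, b] h ->
  (forall t, a <= t <= b -> `|h t| <= M) -> mu.-integrable `[a, b] (EFin \o g) ->
  mu.-integrable `[a, b] (EFin \o (fun t => h t * g t)).
Proof.
move=> mh hM gi.
have mg : measurable_fun `[a, b] g by apply/measurable_EFinP; exact: measurable_int gi.
apply: (le_integrable _ _ _ (integrableZl _ M gi)) => //.
  by apply/measurable_EFinP; exact: measurable_funM.
move=> t; rewrite /= in_itv /= => tab; rewrite lee_fin !normrM ler_wpM2r//.
exact: le_trans (hM t tab) (ler_norm _).
Qed.

Lemma powR_kernel_integrable m a x : 0 < m -> a <= x ->
  mu.-integrable `[a, x] (EFin \o (fun t => (x - t) `^ (m - 1))).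
Proof.
move=> m0 ax; apply/integrableP; split.
  by apply/measurable_EFinP; exact: measurable_funTS (measurable_powR_subr _ _).
under eq_integral do rewrite /= ger0_norm ?powR_ge0//.
by rewrite integral_powR_subr// ltry.
Qed.

Lemma frac_integrable m a x F : 0 < m -> a <= x ->
  {within `[a, x], continuous F} ->
  mu.-integrable `[a, x] (EFin \o (fun t => (x - t) `^ (m - 1) * F t)).
Proof.
move=> m0 ax cF; have [M FM] := within_continuous_bounded cF.
have mF : measurable_fun `[a, x] F.
  by apply/measurable_EFinP; exact: measurable_int (within_continuous_integrable cF).
apply: eq_integrable (integrable_bounded_mul mF FM (powR_kernel_integrable m0 ax)) => //.
by move=> t _ /=; rewrite mulrC.
Qed.

(** Here the kernel is bounded by [(x - a)^p], so [g] need only be integrable; in [frac_integrable]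
    the kernel may be singular and [F] is the bounded factor. *)
Lemma frac_integrable_ge0 (p : R) a x g : 0 <= p -> mu.-integrable `[a, x] (EFin \o g) ->
  mu.-integrable `[a, x] (EFin \o (fun t => (x - t) `^ p * g t)).
Proof.
move=> p0; apply: (@integrable_bounded_mul _ _ _ _ ((x - a) `^ p)).
  exact: measurable_funTS (measurable_powR_subr _ _).
move=> t /andP[at_ tx]; rewrite ger0_norm ?powR_ge0//.
by apply: ge0_ler_powR; rewrite ?nnegrE ?subr_ge0 ?lerB// (le_trans at_).
Qed.

Lemma le_frac m a x F M : 0 < m -> a <= x -> {within `[a, x], continuous F} ->
  (forall t, a <= t <= x -> `|F t| <= M) -> `|frac m a F x| <= M * ((x - a) `^ m / m).
Proof.
move=> m0 ax cF FM; apply: (le_trans (le_normr_Rintegral _ _)) => //.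
  exact: frac_integrable.
rewrite (_ : (x - a) `^ m / m = \int[mu]_(t in `[a, x]) (x - t) `^ (m - 1)); last first.
  by rewrite /Rintegral integral_powR_subr.
rewrite -RintegralZl//; last exact: powR_kernel_integrable.
apply: le_Rintegral => //.
- exact: integrable_norm (frac_integrable m0 ax cF).
- exact: integrableZl (powR_kernel_integrable m0 ax).
move=> t; rewrite /= in_itv /= => tax.
by rewrite normrM (ger0_norm (powR_ge0 _ _)) mulrC ler_wpM2r ?powR_ge0// FM.
Qed.

Lemma frac_linear m a x (c : R) F G : 0 < m -> a <= x ->
  {within `[a, x], continuous F} -> {within `[a, x], continuous G} ->
  frac m a (fun t => c * F t + G t) x = c * frac m a F x + frac m a G x.
Proof.
move=> m0 ax cF cG; rewrite -RintegralZl//; last exact: frac_integrable.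
rewrite -RintegralD//; last 2 first.
- exact: integrableZl (frac_integrable m0 ax cF).
- exact: frac_integrable.
by apply: eq_Rintegral => t _; ring.
Qed.

Lemma eq_frac m a x F G : (forall t, a <= t <= x -> F t = G t) ->
  frac m a F x = frac m a G x.
Proof.
by move=> FG; apply: eq_Rintegral => t; rewrite inE /= in_itv /= => /FG ->.
Qed.

(** Triangle exchange with the kernel [(x - s)^(m - 1)], constant in [t]: its integral over
    [t <= s <= x] is [(x - t)^m / m]. *)
Lemma frac_antider m a x g : 0 < m -> a <= x ->
  mu.-integrable `[a, x] (EFin \o g) ->
  frac m a (antider a g) x = frac (m + 1) a g x / m.
Proof.
move=> m0 ax gi.
have kC t : a <= t <= x ->
    (\int[mu]_(s in `[t, x]) `|(x - s) `^ (m - 1)|%:E <= ((x - a) `^ m / m)%:E)%E.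
  move=> /andP[at_ tx]; under eq_integral do rewrite ger0_norm ?powR_ge0//.
  rewrite integral_powR_subr// lee_fin ler_wpM2r ?invr_ge0 ?(ltW m0)//.
  by apply: ge0_ler_powR; rewrite ?nnegrE ?subr_ge0 ?lerB ?(ltW m0).
have [|_ H] := @triangle_Fubini _ (fun s t => (x - s) `^ (m - 1)) g a x _ _ gi kC.
  exact: (measurableT_comp (measurable_powR_subr _ _)).
transitivity (\int[mu]_(s in `[a, x]) \int[mu]_(t in `[a, s]) ((x - s) `^ (m - 1) * g t)).
  apply: eq_Rintegral => s; rewrite inE /= in_itv /= => /andP[as_ sx].
  rewrite RintegralZl//; apply: integrableS gi => //.
  exact: subset_itvl.
rewrite H -RintegralZr//; last by rewrite addrK; exact: frac_integrable_ge0 (ltW m0) gi.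
apply: eq_Rintegral => t; rewrite inE /= in_itv /= => /andP[at_ tx].
by rewrite /Rintegral integral_powR_subr//= addrK; ring.
Qed.

(** Triangle exchange with the kernel [(s - t)^(m - 1)], whose integral over [t <= s <= x] is again
    [(x - t)^m / m]. For [m < 1] the integral defining [frac m a g] may diverge on a null set, hence
    the separate integrability claim. *)
Lemma antider_frac m a x g : 0 < m -> a <= x ->
  mu.-integrable `[a, x] (EFin \o g) ->
  mu.-integrable `[a, x] (EFin \o frac m a g) /\
  antider a (frac m a g) x = frac (m + 1) a g x / m.
Proof.
move=> m0 ax gi.
have kC t : a <= t <= x ->
    (\int[mu]_(s in `[t, x]) `|(s - t) `^ (m - 1)|%:E <= ((x - a) `^ m / m)%:E)%E.
  move=> /andP[at_ tx]; under eq_integral do rewrite ger0_norm ?powR_ge0//.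
  rewrite integral_powR_subl// lee_fin ler_wpM2r ?invr_ge0 ?(ltW m0)//.
  by apply: ge0_ler_powR; rewrite ?nnegrE ?subr_ge0 ?lerB ?(ltW m0).
have [|Hi H] := @triangle_Fubini _ (fun s t => (s - t) `^ (m - 1)) g a x _ _ gi kC.
  apply: (measurableT_comp (measurable_powR _)).
  exact: measurable_funB.
split=> //; rewrite /antider {}H -RintegralZr//; last first.
  by rewrite addrK; exact: frac_integrable_ge0 (ltW m0) gi.
apply: eq_Rintegral => t; rewrite inE /= in_itv /= => /andP[at_ tx].
by rewrite /Rintegral integral_powR_subl//= addrK; ring.
Qed.

Lemma antider_continuous a b g : a <= b -> mu.-integrable `[a, b] (EFin \o g) ->
  {within `[a, b], continuous (antider a g)}.
Proof. exact: parameterized_integral_continuous. Qed.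

(** Since [g] is only integrable, the product rule is replaced by a triangle exchange with kernel
    [psi s]: its integral over [t <= s <= b] is [- phi t] because [phi b = 0]. *)
Lemma antider_by_parts a b g (phi psi : R -> R) : a <= b ->
  mu.-integrable `[a, b] (EFin \o g) ->
  (forall t : R, is_derive t 1 phi (psi t)) -> continuous psi -> phi b = 0 ->
  \int[mu]_(t in `[a, b]) (g t * phi t) =
  - \int[mu]_(t in `[a, b]) (antider a g t * psi t).
Proof.
move=> ab gi dphi cpsi phib.
have FTC t : a <= t <= b -> (\int[mu]_(s in `[t, b]) (psi s)%:E = (- phi t)%:E)%E.
  move=> /andP[at_]; rewrite le_eqVlt => /predU1P[->|tb].
    by rewrite set_itv1 integral_set1 phib oppr0.
  rewrite (@continuous_FTC2 _ _ phi)//.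
  - by rewrite phib sub0e.
  - exact: continuous_subspaceT.
  - split; first by move=> s _; have [] := dphi s.
    + by apply: cvg_at_right_filter; exact: (is_derive_continuous (dphi t)).
    + by apply: cvg_at_left_filter; exact: (is_derive_continuous (dphi b)).
  - by move=> s _; rewrite derive1E; have [_] := dphi s.
have mpsi : measurable_fun setT psi by exact: continuous_measurable_fun.
have psii : mu.-integrable `[a, b] (EFin \o psi).
  by apply: within_continuous_integrable; exact: continuous_subspaceT.
have kC t : a <= t <= b -> (\int[mu]_(s in `[t, b]) `|psi s|%:E <=
    (\int[mu]_(s in `[a, b]) `|psi s|)%:E)%E.
  move=> /andP[at_ tb]; rewrite /Rintegral fineK; last first.
    exact: integrable_fin_num (integrable_norm psii).
  apply: ge0_subset_integral => //.
    apply/measurable_EFinP/measurableT_comp => //; exact: measurable_funTS.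
  exact: subset_itvr.
have [|_ H] := @triangle_Fubini _ (fun s t => psi s) g a b _ _ gi kC.
  exact: (measurableT_comp mpsi).
transitivity (- \int[mu]_(s in `[a, b]) \int[mu]_(t in `[a, s]) (psi s * g t)).
  have cphi : continuous phi by move=> t; exact: is_derive_continuous (dphi t).
  have [M phiM] := within_continuous_bounded (@continuous_subspaceT _ _ `[a, b] _ cphi).
  have gphii := integrable_bounded_mul
    (measurable_funTS (continuous_measurable_fun cphi)) phiM gi.
  rewrite H -mulN1r; under eq_Rintegral do rewrite mulrC.
  transitivity (-1 * \int[mu]_(t in `[a, b]) (-1 * (phi t * g t))).
    by rewrite RintegralZl//; ring.
  congr (_ * _); apply: eq_Rintegral => t; rewrite inE /= in_itv /= => tab.
  by rewrite /Rintegral FTC//=; ring.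
congr (- _); apply: eq_Rintegral => s; rewrite inE /= in_itv /= => /andP[as_ sx].
rewrite RintegralZl ?(mulrC (psi s))//; apply: integrableS gi => //.
exact: subset_itvl.
Qed.

End fractional_kernel.

(** * Smooth bump functions *)

Section smooth_upto.
Variable R : realType.
Implicit Types (f g : R -> R) (k : nat).

(** The recursion removes the innermost derivative, so an explicit formula for [derive1 f] can be
    substituted before differentiating further; [iterSr] translates this back to [derive1n]. *)
Fixpoint smooth_upto k f : Prop :=
  (forall x : R, derivable f x 1) /\ if k is k'.+1 then smooth_upto k' (derive1 f) else True.

Lemma smooth_upto_derivable k f : smooth_upto k f -> forall x : R, derivable f x 1.
Proof. by case: k => [|k] []. Qed.

Lemma smooth_uptoS k f : smooth_upto k.+1 f -> smooth_upto k f.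
Proof. by elim: k f => [|k IH] f [df sf]; split=> //; exact: IH. Qed.

Lemma smooth_upto_derive1n k f (x : R) : smooth_upto k f -> derivable (derive1n k f) x 1.
Proof.
elim: k f => [|k IH] f [df sf]; first exact: df.
by rewrite /derive1n iterSr; exact: IH.
Qed.

Lemma smooth_upto_continuous k f : smooth_upto k f -> continuous f.
Proof.
by move=> /smooth_upto_derivable df x; exact/differentiable_continuous/derivable1_diffP.
Qed.

Lemma smooth_uptoD k f g : smooth_upto k f -> smooth_upto k g ->
  smooth_upto k (fun x => f x + g x).
Proof.
elim: k f g => [|k IH] f g [df sf] [dg sg].
  by split; [move=> x; exact: derivableD|exact: I].
split; first by move=> x; exact: derivableD.
have -> : derive1 (fun x => f x + g x) = (fun x => derive1 f x + derive1 g x).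
  by apply/funext => x; rewrite !derive1E deriveD.
exact: IH.
Qed.

Lemma smooth_uptoM k f g : smooth_upto k f -> smooth_upto k g ->
  smooth_upto k (fun x => f x * g x).
Proof.
elim: k f g => [|k IH] f g [df sf] [dg sg].
  by split; [move=> x; exact: derivableM|exact: I].
split; first by move=> x; exact: derivableM.
have -> : derive1 (fun x => f x * g x) = (fun x => f x * derive1 g x + g x * derive1 f x).
  by apply/funext => x; rewrite !derive1E deriveM.
by apply: smooth_uptoD; apply: IH => //; exact: smooth_uptoS.
Qed.

Lemma smooth_upto_cst k (c : R) : smooth_upto k (fun=> c).
Proof.
elim: k c => [|k IH] c; split; try exact: I; try by move=> x; exact: derivable_cst.
have -> : derive1 (fun=> c) = (fun=> 0) :> (R -> R).
  by apply/funext => x; rewrite derive1E derive_cst.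
exact: IH.
Qed.

Lemma smooth_upto_affine k (c d : R) f : smooth_upto k f ->
  smooth_upto k (fun x => f (c * x + d)).
Proof.
elim: k f => [|k IH] f sf; have df := smooth_upto_derivable sf.
  split; last exact: I.
  move=> x; apply: diff_derivable.
  by apply: (@differentiable_comp _ _ _ _ (fun x : R => c * x + d) f) => //;
    exact/derivable1_diffP.
have H (x : R) : is_derive x 1 (fun x => f (c * x + d)) (c * derive1 f (c * x + d)).
  have h1 : is_derive x 1 (fun x : R => c * x + d) c.
    by apply: is_derive_eq; rewrite addr0 /GRing.scale /= mulr1.
  have h2 : is_derive (c * x + d) 1 f (derive1 f (c * x + d)).
    by split; [exact: df|rewrite derive1E].
  by rewrite mulrC; exact: (@is_derive1_comp _ f (fun x : R => c * x + d) _ _ _ h2 h1).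
split; first by move=> x; have [] := H x.
have -> : derive1 (fun x => f (c * x + d)) = (fun x => c * derive1 f (c * x + d)).
  by apply/funext => x; rewrite derive1E; have [_] := H x.
apply: smooth_uptoM; first exact: smooth_upto_cst.
by apply: IH; case: sf.
Qed.

End smooth_upto.

Section bump.
Variable R : realType.

Definition expNV (n : nat) (x : R) : R :=
  if 0 < x then (x^-1) ^+ n * expR (- x^-1) else 0.

(** With [u = 1 / x], the exponential series gives [exp u >= u^(n+2) / (n+2)!]. Order 2 is what
    makes the derivative at 0 vanish. *)
Lemma expNV_le (n : nat) (x : R) : 0 <= expNV n x <= (n.+2)`!%:R * x ^+ 2.
Proof.
rewrite /expNV; case: ifPn => x0; last by rewrite lexx mulr_ge0 ?ler0n ?sqr_ge0.
have ix : 0 < x^-1 by rewrite invr_gt0.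
rewrite mulr_ge0 ?expR_ge0 ?exprn_ge0 ?(ltW ix)//= expRN ler_pdivrMr ?expR_gt0//.
have fact0 : 0 < ((n.+2)`!%:R : R) by rewrite ltr0n fact_gt0.
rewrite -mulrA -ler_pdivrMl// -ler_pdivrMl ?exprn_gt0//.
have : (x^-1) ^+ n.+2 / (n.+2)`!%:R <= expR x^-1.
  by apply: le_trans (expR_ge1Dxn n.+1 (ltW ix)); rewrite lerDr.
apply: le_trans; rewrite le_eqVlt; apply/orP; left; apply/eqP.
have -> : (x^-1) ^+ n.+2 = (x^-1) ^+ n * (x^-1) ^+ 2 by rewrite -exprD addn2.
by rewrite -exprVn [LHS]mulrC -[LHS]mulrA [LHS]mulrC.
Qed.

Lemma is_derive0_quadratic (f : R -> R) (C : R) : (forall x, `|f x| <= C * x ^+ 2) ->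
  is_derive (0 : R) 1 f 0.
Proof.
move=> fC.
have f0 : f 0 = 0.
  apply/normr0_eq0/le_anti.
  by rewrite normr_ge0 (le_trans (fC 0))// expr0n mulr0.
have C0 : 0 <= C by have := fC 1; rewrite expr1n mulr1; exact: le_trans.
have H : (fun h : R => h^-1 *: ((f \o shift 0) (h *: 1) - f 0)) @ 0^' --> (0 : R).
  apply/cvgrPdist_le => e e0; near=> h.
  have hN0 : h != 0 by near: h; exact: nbhs_dnbhs_neq.
  rewrite /= sub0r normrN f0 subr0 addr0 /GRing.scale /= mulr1 normrM normfV.
  rewrite mulrC ler_pdivrMr ?normr_gt0//.
  have hE : h ^+ 2 = `|h| * `|h| by rewrite -normrM -expr2 ger0_norm ?sqr_ge0.
  apply: le_trans (fC h) _; rewrite hE mulrA ler_wpM2r//.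
  (* [C] may be 0, so the division is by [C + 1]. *)
  have C1 : 0 < C + 1 by lra.
  apply: (@le_trans _ _ ((C + 1) * `|h|)); first by rewrite ler_wpM2r// lerDl.
  rewrite -ler_pdivlMl//; near: h.
  by apply: dnbhs0_le; rewrite mulr_gt0// invr_gt0; lra.
split; first exact: cvgP H.
exact: cvg_lim H.
Unshelve. all: by end_near. Qed.

(** Left of 0 the function is locally zero, right of 0 the product and chain rules apply, and at 0
    the quadratic bound gives derivative 0. *)
Lemma is_derive_expNV (n : nat) (x : R) :
  is_derive x 1 (expNV n) (- n%:R * expNV n.+1 x + expNV n.+2 x).
Proof.
have [x0|x0|->] := ltgtP x 0.
- rewrite /expNV !ltNge (ltW x0) /= mulr0 addr0.
  apply: near_eq_is_derive (is_derive_cst (0 : R) x 1).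
  near=> y; rewrite ltNge ifN// negbK; apply: ltW.
  by near: y; exact: lt_nbhsl.
- have iD : is_derive x 1 (fun y : R => y^-1) (- (x ^- 2)).
    have h := @is_deriveV R id x 1 1 _ (is_derive_id x 1).
    apply: is_derive_eq; first by apply: h; exact: lt0r_neq0.
    by rewrite /GRing.scale /= mulr1.
  have eD := @is_derive1_comp R expR (fun y : R => - y^-1) x _ _
    (is_derive_expR (- x^-1)) (is_deriveN iD).
  have pD := is_deriveM (is_deriveX n iD) eD.
  have -> : - n%:R * expNV n.+1 x + expNV n.+2 x =
     (x^-1) ^+ n *: (expR (- x^-1) * - - x ^- 2) +
     (expR (- x^-1)) *: (n%:R * (x^-1) ^+ n.-1 *: - x ^- 2).
    rewrite /expNV x0 /GRing.scale /= opprK -!exprVn.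
    by case: n {pD} => [|n] /=; rewrite ?mulr0n -?natr1 ?exprS; ring.
  rewrite exprfctE in pD; apply: near_eq_is_derive pD.
  by near=> y; rewrite /expNV ifT//; near: y; exact: lt_nbhsr.
- have -> : - n%:R * expNV n.+1 0 + expNV n.+2 0 = 0 by rewrite /expNV ltxx mulr0 addr0.
  apply: (@is_derive0_quadratic _ (n.+2)`!%:R) => y.
  by have /andP[h0 h1] := expNV_le n y; rewrite ger0_norm.
Unshelve. all: by end_near. Qed.

(* The family [expNV n], with [n] varying, is stable under differentiation;
   exp (- 1 / x) alone is not. *)
Lemma smooth_upto_expNV k n : smooth_upto k (expNV n).
Proof.
elim: k n => [|k IH] n; split; try exact: I; try by move=> x; have [] := is_derive_expNV n x.
have -> : derive1 (expNV n) = (fun x => - n%:R * expNV n.+1 x + expNV n.+2 x).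
  by apply/funext => x; rewrite derive1E; have [_] := is_derive_expNV n x.
by apply: smooth_uptoD => //; apply: smooth_uptoM => //; exact: smooth_upto_cst.
Qed.

Definition bump (c d x : R) : R := expNV 0 (x - c) * expNV 0 (d - x).

Lemma smooth_upto_bump k c d : smooth_upto k (bump c d).
Proof.
apply: smooth_uptoM.
  have := smooth_upto_affine 1 (- c) (smooth_upto_expNV k 0).
  by under eq_fun do rewrite mul1r.
have := smooth_upto_affine (-1) d (smooth_upto_expNV k 0).
by under eq_fun do rewrite mulN1r addrC.
Qed.

Lemma bump_ge0 c d x : 0 <= bump c d x.
Proof.
by apply: mulr_ge0; [have /andP[] := expNV_le 0 (x - c)|have /andP[] := expNV_le 0 (d - x)].
Qed.

Lemma bump_eq0 c d x : x <= c \/ d <= x -> bump c d x = 0.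
Proof.
by rewrite /bump /expNV !subr_gt0 !ltNge; case=> -> /=; rewrite ?mul0r ?mulr0.
Qed.

Lemma bump_gt0 c d x : c < x < d -> 0 < bump c d x.
Proof.
by move=> /andP[cx xd]; rewrite /bump /expNV !subr_gt0 cx xd !expr0 !mul1r mulr_gt0 ?expR_gt0.
Qed.

End bump.

(** * Uniqueness of primitives *)

Section du_Bois_Reymond.
Variable R : realType.
Implicit Types (a b c d : R) (H : R -> R).
Local Notation mu := (@lebesgue_measure R).

Lemma continuous_bump c d : continuous (@bump R c d).
Proof. exact: smooth_upto_continuous (smooth_upto_bump 0 c d). Qed.

Lemma integrable_mul_continuous a b H (psi : R -> R) :
  {within `[a, b], continuous H} -> continuous psi ->
  mu.-integrable `[a, b] (EFin \o (fun t => H t * psi t)).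
Proof.
move=> cH cpsi; apply: within_continuous_integrable => x.
by apply: continuousM; [exact: cH|exact: continuous_subspaceT].
Qed.

(** On the middle third of [[c, d]] the bump attains a positive minimum, which bounds the integral
    from below. *)
Lemma bump_integral_gt0 a b c d : a <= c -> c < d -> d <= b ->
  0 < \int[mu]_(t in `[a, b]) bump c d t.
Proof.
move=> ac cd db.
pose h := (d - c) / 3.
have h0 : 0 < h by rewrite divr_gt0// subr_gt0.
have hE : d = c + 3 * h by rewrite /h; field.
have [x0 x0i x0min] := @EVT_min _ (bump c d) (c + h) (d - h) ltac:(lra)
  (continuous_subspaceT (@continuous_bump c d)).
have v0 : 0 < bump c d x0.
  by move: x0i; rewrite in_itv /= => /andP[? ?]; apply: bump_gt0; lra.
have mb : measurable_fun setT (bump c d).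
  exact: continuous_measurable_fun (@continuous_bump c d).
have bi : mu.-integrable `[a, b] (EFin \o bump c d).
  by apply: within_continuous_integrable; apply: continuous_subspaceT; exact: continuous_bump.
have bi' : mu.-integrable `[c + h, d - h] (EFin \o bump c d).
  by apply: within_continuous_integrable; apply: continuous_subspaceT; exact: continuous_bump.
apply: (@lt_le_trans _ _ (\int[mu]_(t in `[c + h, d - h]) bump c d t)); last first.
  rewrite fine_le//; [exact: integrable_fin_num bi'|exact: integrable_fin_num bi|].
  apply: ge0_subset_integral => //.
  - exact/measurable_EFinP/measurable_funTS.
  - by move=> t _; rewrite lee_fin bump_ge0.
  - by move=> t /=; rewrite !in_itv /=; lra.
apply: (@lt_le_trans _ _ (\int[mu]_(t in `[c + h, d - h]) bump c d x0)); last first.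
  apply: le_Rintegral => //.
    by apply: within_continuous_integrable; apply: continuous_subspaceT; exact: cst_continuous.
rewrite Rintegral_cst//= lebesgue_measure_itv /= lte_fin ifT; last lra.
by rewrite -EFinB /= mulr_gt0//; lra.
Qed.

(** If [H y > C], then [H] exceeds the midpoint [m] of [C] and [H y] near [y], and a bump supported
    there contradicts the hypothesis. *)
Lemma du_Bois_Reymond_le a b H C : {within `[a, b], continuous H} ->
  (forall c d, a < c -> c < d -> d < b ->
    \int[mu]_(t in `[a, b]) (H t * bump c d t) <= C * \int[mu]_(t in `[a, b]) bump c d t) ->
  forall y, a < y < b -> H y <= C.
Proof.
move=> cH Hb y /andP[ay yb]; rewrite leNgt; apply/negP => CH.
have ab : a < b by exact: lt_trans yb.
have [cHo _ _] := (continuous_within_itvP H ab).1 cH.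
have yab : y \in `]a, b[ by rewrite in_itv /= ay.
pose m := (C + H y) / 2.
have mH : m < H y by rewrite /m; lra.
have : \forall t \near y, m < H t := cvgr_gt _ (cHo y yab) _ mH.
move=> [e /= e0 eH].
pose r := Num.min (e / 2) (Num.min ((y - a) / 2) ((b - y) / 2)).
have [r0 re ra rb] : [/\ 0 < r, r < e, r < y - a & r < b - y].
  split.
  - by rewrite !lt_min !divr_gt0 ?subr_gt0.
  - by rewrite gt_min; apply/orP; left; lra.
  - by rewrite !gt_min; apply/orP; right; apply/orP; left; lra.
  - by rewrite !gt_min; apply/orP; right; apply/orP; right; lra.
have Hm t : m * bump (y - r) (y + r) t <= H t * bump (y - r) (y + r) t.
  have [tr|tr] := leP t (y - r); first by rewrite bump_eq0 ?mulr0//; left.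
  have [rt|rt] := leP (y + r) t; first by rewrite bump_eq0 ?mulr0//; right.
  rewrite ler_wpM2r ?bump_ge0// ltW//; apply: eH => /=.
  by rewrite ltr_distl; lra.
have bi : mu.-integrable `[a, b] (EFin \o bump (y - r) (y + r)).
  by apply: within_continuous_integrable; apply: continuous_subspaceT; exact: continuous_bump.
have I0 : 0 < \int[mu]_(t in `[a, b]) bump (y - r) (y + r) t.
  by apply: bump_integral_gt0; lra.
have := Hb (y - r) (y + r) ltac:(lra) ltac:(lra) ltac:(lra).
apply/negP; rewrite -ltNge.
apply: (@lt_le_trans _ _ (\int[mu]_(t in `[a, b]) (m * bump (y - r) (y + r) t))).
  by rewrite RintegralZl// ltr_pM2r// /m; lra.
apply: le_Rintegral => //.
- exact: integrableZl bi.
- by apply: integrable_mul_continuous => //; exact: continuous_bump.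
Qed.

Lemma du_Bois_Reymond a b H C : {within `[a, b], continuous H} ->
  (forall c d, a < c -> c < d -> d < b ->
    \int[mu]_(t in `[a, b]) (H t * bump c d t) = C * \int[mu]_(t in `[a, b]) bump c d t) ->
  forall y, a < y < b -> H y = C.
Proof.
move=> cH Hb y yab; apply/eqP; rewrite eq_le; apply/andP; split.
  by apply: (du_Bois_Reymond_le cH _ yab) => c d ac cd db; rewrite Hb.
rewrite -lerN2; apply: (@du_Bois_Reymond_le a b (fun t => - H t) (- C) _ _ _ yab).
  by move=> x; apply: continuousN; exact: cH.
move=> c d ac cd db; rewrite mulNr -Hb//.
have := @integrable_mul_continuous a b H (bump c d) cH (@continuous_bump c d).
move=> /RintegralZl -/(_ (-1)); rewrite mulN1r => <- //.
by under eq_Rintegral do rewrite mulNr -mulN1r.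
Qed.

End du_Bois_Reymond.

Section primitive_unique.
Variable R : realType.
Variables a b : R.
Hypothesis ab : a < b.
Implicit Types (f : dist R) (F G phi : R -> R).
Local Notation mu := (@lebesgue_measure R).

Lemma test_fun_derive phi : test_fun a b phi ->
  [/\ forall t : R, is_derive t 1 phi (derive1 phi t), continuous (derive1 phi) & phi b = 0].
Proof.
move=> [dphi [c [d [ac db phi0]]]]; split.
- by move=> t; split; [exact: dphi 0%N t|rewrite derive1E].
- by move=> t; exact/differentiable_continuous/derivable1_diffP/(dphi 1%N).
- by apply: phi0; right.
Qed.

(** The vanishing total integral makes the antiderivative return to 0 right of [d], so its support
    stays inside [(a, b)]. *)
Lemma test_fun_antider (theta : R -> R) c d : (forall k, smooth_upto k theta) ->
  a < c -> d < b -> (forall t, t <= c \/ d <= t -> theta t = 0) ->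
  \int[mu]_(t in `[a, b]) theta t = 0 ->
  test_fun a b (antider a theta) /\ derive1 (antider a theta) = theta.
Proof.
move=> sth ac db th0 int0.
have cth : continuous theta by exact: smooth_upto_continuous (sth 0%N).
have itheta u v : mu.-integrable `[u, v] (EFin \o theta).
  by apply: within_continuous_integrable; exact: continuous_subspaceT.
(* This includes [x < a], where the interval of integration is empty. *)
have antider0 x : x <= c -> antider a theta x = 0.
  move=> xc; transitivity (\int[mu]_(t in `[a, x]) (0 : R)).
    2: by rewrite Rintegral_cst// mul0r.
  apply: eq_Rintegral => t; rewrite inE /= in_itv /= => /andP[_ tx].
  by apply: th0; left; exact: le_trans xc.
have dA (x : R) : is_derive x 1 (antider a theta) (theta x).
  have [xc|cx] := ltP x c.
    rewrite th0; last by left; exact: ltW.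
    apply: near_eq_is_derive (is_derive_cst (0 : R) x 1).
    near=> t; rewrite antider0//; apply: ltW.
    by near: t; exact: lt_nbhsl.
  have xx1 : x < x + 1 by rewrite ltrDl.
  have [d1 d2] := continuous_FTC1_closed xx1 (itheta _ _) (lt_le_trans ac cx) (cth x).
  by split; [exact: d1|rewrite -derive1E].
have dE : derive1 (antider a theta) = theta.
  by apply/funext => x; rewrite derive1E; have [] := dA x.
split=> //; split.
  move=> [|k] x; first by have [] := dA x.
  by rewrite /derive1n iterSr dE; exact: smooth_upto_derive1n.
exists c, d; split=> // x [xc|dx]; first exact/antider0/ltW.
apply: etrans int0; rewrite /antider Rintegral_mkcond [RHS]Rintegral_mkcond.
apply: eq_Rintegral => t _.
rewrite !patchE !mem_setE !in_itv /=.
have [dt|td] := leP d t; first by rewrite th0 ?if_same//; right.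
have -> : t <= x by rewrite ltW// (lt_trans td).
by have -> : t <= b by rewrite ltW// (lt_trans td).
Unshelve. all: by end_near. Qed.

(** Subtracting a multiple of one fixed bump from any other gives integral 0, hence the derivative
    of a test function. Orthogonality then makes [H] constant inside [(a, b)]; continuity carries
    the constant to the endpoints and [H a = 0] identifies it. *)
Lemma orthogonal_test_derivative_eq0 (H : R -> R) :
  {within `[a, b], continuous H} -> H a = 0 ->
  (forall phi, test_fun a b phi -> \int[mu]_(t in `[a, b]) (H t * derive1 phi t) = 0) ->
  forall x, a <= x <= b -> H x = 0.
Proof.
move=> cH Ha Hphi.
pose c0 := a + (b - a) / 3; pose d0 := b - (b - a) / 3.
have ba : 0 < (b - a) / 3 by rewrite divr_gt0// subr_gt0.
have [ac0 cd0 db0] : [/\ a < c0, c0 < d0 & d0 < b] by rewrite /c0 /d0; split; lra.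
pose I0 := \int[mu]_(t in `[a, b]) bump c0 d0 t.
have I0gt0 : 0 < I0 by apply: bump_integral_gt0; rewrite ?ltW.
have bi c d : mu.-integrable `[a, b] (EFin \o bump c d).
  by apply: within_continuous_integrable; apply: continuous_subspaceT; exact: continuous_bump.
have Hbi c d := integrable_mul_continuous cH (@continuous_bump R c d).
pose C := (\int[mu]_(t in `[a, b]) (H t * bump c0 d0 t)) / I0.
have HC y : a < y < b -> H y = C.
  apply: (du_Bois_Reymond cH) => c d ac cd db.
  (* The coefficient for which [theta] has integral 0. *)
  pose l := (\int[mu]_(t in `[a, b]) bump c d t) / I0.
  pose theta t := bump c d t + (- l) * bump c0 d0 t.
  have [|||t ht||tf dE] := @test_fun_antider theta (Num.min c c0) (Num.max d d0).
  - move=> k; apply: smooth_uptoD; first exact: smooth_upto_bump.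
    by apply: smooth_uptoM; [exact: smooth_upto_cst|exact: smooth_upto_bump].
  - by rewrite lt_min ac.
  - by rewrite gt_max db.
  - rewrite /theta !bump_eq0 ?mulr0 ?addr0//.
      by case: ht; rewrite ?le_min ?ge_max => /andP[]; [left|right].
    by case: ht; rewrite ?le_min ?ge_max => /andP[]; [left|right].
  - rewrite RintegralD//; last exact: integrableZl (bi c0 d0).
    by rewrite RintegralZl// mulNr /l -/I0 divfK ?subrr// gt_eqF.
  have := Hphi _ tf; rewrite dE /theta.
  under eq_Rintegral do rewrite mulrDr (mulrCA _ (- l)).
  rewrite RintegralD//; last exact: integrableZl (Hbi c0 d0).
  rewrite RintegralZl// => /eqP; rewrite mulNr subr_eq0 => /eqP ->.
  by rewrite /l /C; ring.
have [_ cHa cHb] := (continuous_within_itvP H ab).1 cH.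
have HaC : H a = C.
  have HC' : H x @[x --> a^'+] --> C.
    apply: cvg_near_cst; near=> t; apply/HC/andP; split=> //.
  exact: cvg_unique cHa HC'.
have HbC : H b = C.
  have HC' : H x @[x --> b^'-] --> C.
    apply: cvg_near_cst; near=> t; apply/HC/andP; split=> //.
  exact: cvg_unique cHb HC'.
move=> x /andP[]; rewrite le_eqVlt => /predU1P[<- //|ax].
rewrite le_eqVlt => /predU1P[->|xb]; first by rewrite HbC -HaC.
by rewrite HC ?ax// -HaC.
Unshelve. all: by end_near. Qed.

Lemma prim_unique f F G : is_prim a b f F -> is_prim a b f G ->
  forall x, a <= x <= b -> F x = G x.
Proof.
move=> [cF Fa fF] [cG Ga fG] x xab; apply/eqP; rewrite -subr_eq0; apply/eqP.
have cFG : {within `[a, b], continuous (fun t => F t - G t)}.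
  by move=> t; apply: continuousB; [exact: cF|exact: cG].
apply: (@orthogonal_test_derivative_eq0 (fun t => F t - G t)) => //.
  by rewrite Fa Ga subrr.
move=> phi tphi; have [_ cphi _] := test_fun_derive tphi.
under eq_Rintegral do rewrite mulrBl.
rewrite RintegralB//; [|exact: integrable_mul_continuous|exact: integrable_mul_continuous].
by apply/eqP; rewrite subr_eq0 -eqr_opp -fF// -fG.
Qed.

End primitive_unique.

(** * Density of primitives of integrable functions *)

Section density.
Variable R : realType.
Implicit Types (a b m x : R) (g F : R -> R).
Local Notation mu := (@lebesgue_measure R).

(** The averages used for density look to the left of [a]; clamping the argument supplies values
    there, constantly [F a]. *)
Lemma continuous_extension a b F : a <= b -> {within `[a, b], continuous F} ->
  continuous (fun x => F (Num.max a (Num.min x b))).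
Proof.
move=> ab cF x.
have clampP y : a <= Num.max a (Num.min y b) <= b.
  by rewrite le_max lexx /= ge_max ab /= ge_min lexx orbT.
have cc : {for x, continuous (fun y : R => Num.max a (Num.min y b))}.
  apply: (@continuous_max _ _ (cst a) (fun y => Num.min y b)); first exact: cst_continuous.
  apply: (@continuous_min _ _ id (cst b)); first exact: cvg_id.
  exact: cst_continuous.
have H := (subspace_continuousP _ _).1 cF (Num.max a (Num.min x b)).
apply: (@cvg_comp _ _ _ (fun y => Num.max a (Num.min y b)) F _ _ _ _ (H _)).
  2: by rewrite /= in_itv /= clampP.
move=> P; rewrite /within /= => /cc; apply: (@filterS _ (nbhs x)) => y /= Q; apply: Q.
by rewrite in_itv /= clampP.
Qed.

(** Compactness of [[a, b]] in near-covering form: it suffices to find, around each point, a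
    neighbourhood and a range of [h] that work together. *)
Lemma uniform_left_continuity a b F : continuous F -> forall e : R, 0 < e ->
  \forall h \near 0^'+, forall x, a <= x <= b -> forall s, 0 <= s <= h ->
    `|F (x - s) - F x| <= e.
Proof.
move=> cF e e0.
have /compact_near_coveringP cover := @segment_compact R a b.
have H : \forall h \near 0^'+, `[a, b]%classic `<=`
    (fun x => forall s, 0 <= s <= h -> `|F (x - s) - F x| <= e).
  apply: cover => x _.
  have e2 : 0 < e / 2 by rewrite divr_gt0.
  have /cvgrPdist_le /(_ _ e2) [d /= d0 dF] := cF x.
  (* Halving [d] keeps both [x'] and [x' - s] within [d] of [x]. *)
  exists (ball x (d / 2), [set h | h < d / 2]) => /=.
    split; first by apply: nbhsx_ballx; rewrite divr_gt0.
    by apply: nbhs_right_lt; rewrite divr_gt0.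
  move=> [x' h] /= [xx' hd] s /andP[s0 sh].
  rewrite (le_trans (ler_distD (F x) _ _))// [leRHS](splitr e) lerD//.
    rewrite distrC; apply: dF => /=; move: xx'; rewrite /ball /= !ltr_distl; lra.
  apply: dF => /=; move: xx'; rewrite /ball /= !ltr_distl; lra.
apply: filterS H => h H x xab; apply: H; rewrite /= in_itv /=; exact: xab.
Qed.

(* The Steklov averages (1/h) \int_(x-h)^x F are primitives of the continuous
   functions (F x - F (x - h)) / h and converge to F uniformly. *)
Lemma antider_dense a b F : a <= b -> {within `[a, b], continuous F} -> F a = 0 ->
  forall e, 0 < e -> exists g : R -> R, continuous g /\
    forall x, a <= x <= b -> `|antider a g x - F x| <= e.
Proof.
move=> ab cF Fa e e0.
pose E x := F (Num.max a (Num.min x b)).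
have EF x : a <= x <= b -> E x = F x.
  by move=> /andP[ax xb]; rewrite /E (min_idPl xb) (max_idPr ax).
have E0 x : x <= a -> E x = 0.
  by move=> xa; rewrite /E (min_idPl (le_trans xa ab)) (max_idPl xa).
have cE : continuous E by exact: continuous_extension.
have Ei u v : mu.-integrable `[u, v] (EFin \o E).
  by apply: within_continuous_integrable; exact: continuous_subspaceT.
have : \forall h \near 0^'+, 0 < h /\ h < 1 /\ forall x, a <= x <= b ->
    forall s, 0 <= s <= h -> `|E (x - s) - E x| <= e.
  near=> h; split; last split.
  - by near: h; exact: nbhs_right_gt.
  - by near: h; exact: nbhs_right_lt.
  - by near: h; exact: uniform_left_continuity.
move=> /(@filter_ex _ _ _) [h [h0 [h1 hE]]].
(* As [h < 1], a point [x > a - 1] has [x - h > a - 2], so [P] is differentiable at both [x] and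
   [x - h]. *)
pose P := antider (a - 2) E.
have dP (x : R) : a - 2 < x -> is_derive x 1 P (E x).
  move=> ax; have xx1 : x < x + 1 by rewrite ltrDl.
  have [d1 d2] := continuous_FTC1_closed xx1 (Ei _ _) ax (cE x).
  by split; [exact: d1|rewrite -derive1E].
pose g x := (E x - E (x - h)) / h.
have cEh : continuous (fun x => E (x - h)).
  move=> x; apply: (@continuous_comp _ _ _ (fun y => y - h) E); last exact: cE.
  by apply: continuousB; [exact: cvg_id|exact: cst_continuous].
have cg : continuous g.
  by move=> x; apply: cvgMr_tmp; apply: cvgB; [exact: cE|exact: cEh].
pose S x := (P x - P (x - h)) / h.
have dS (x : R) : a - 1 < x -> is_derive x 1 S (g x).
  move=> ax.
  have d1 : is_derive x 1 P (E x) by apply: dP; lra.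
  have d2 : is_derive (x - h) 1 P (E (x - h)) by apply: dP; lra.
  have d3 : is_derive x 1 (fun y : R => y - h) 1.
    by apply: is_derive_eq; rewrite oppr0 addr0.
  have d4 := @is_derive1_comp _ P (fun y : R => y - h) _ _ _ d2 d3.
  have d5 := is_deriveM (is_deriveB d1 d4) (is_derive_cst h^-1 x 1).
  by apply: is_derive_eq d5 _; rewrite /GRing.scale /= mulr0 add0r mulr1 mulrC.
(* By the mean value theorem the average is a value of [E] at distance at most [h] to the left. This
   gives the uniform estimate, and also [S a = 0], since [E] vanishes left of [a]. *)
have SE x : a - 1 < x -> exists2 s, 0 <= s <= h & S x = E (x - s).
  move=> ax.
  have xh : x - h < x by lra.
  have [t|t|c cx Pc] := @MVT _ P E _ _ xh.
  - by rewrite in_itv /= => /andP[t1 t2]; apply: dP; lra.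
  - apply: continuous_in_subspaceT => y; rewrite inE /= in_itv /= => /andP[y1 y2].
    by apply: is_derive_continuous; apply: dP; lra.
  move: cx; rewrite in_itv /= => /andP[c1 c2].
  exists (x - c); first by lra.
  rewrite /S Pc (_ : x - (x - h) = h); last by ring.
  by rewrite mulfK ?gt_eqF//; congr E; ring.
exists g; split=> // x /andP[ax xb].
have -> : antider a g x = S x.
  have [s /andP[s0 _] Sa] := SE a ltac:(lra).
  have Sa0 : S a = 0 by rewrite Sa E0//; lra.
  move: ax; rewrite le_eqVlt => /predU1P[<-|ax].
    by rewrite /antider set_itv1 Rintegral_set1 Sa0.
  rewrite /antider /Rintegral (@continuous_FTC2 _ g S a x ax) ?Sa0 ?sube0//.
  - exact: continuous_subspaceT.
  - split.
    + by move=> t; rewrite in_itv /= => /andP[t1 _]; have [] := dS t ltac:(lra).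
    + by apply: cvg_at_right_filter; apply: is_derive_continuous; apply: dS; lra.
    + by apply: cvg_at_left_filter; apply: is_derive_continuous; apply: dS; lra.
  - move=> t; rewrite in_itv /= => /andP[t1 _].
    by rewrite derive1E; have [] := dS t ltac:(lra).
have [s sh ->] := SE x ltac:(lra).
by rewrite -EF ?ax//; apply: hE; rewrite ?ax.
Unshelve. all: by end_near. Qed.

Lemma le_powR_div m a b x : 0 < m -> a <= x <= b ->
  (x - a) `^ m / m <= (b - a) `^ m / m.
Proof.
move=> m0 /andP[ax xb]; rewrite ler_wpM2r ?invr_ge0 ?(ltW m0)//.
by apply: ge0_ler_powR; rewrite ?nnegrE ?subr_ge0 ?lerD2r ?(ltW m0)// (le_trans ax).
Qed.

Lemma le_frac_sub m a b F G M : 0 < m ->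
  {within `[a, b], continuous F} -> {within `[a, b], continuous G} ->
  (forall t, a <= t <= b -> `|F t - G t| <= M) ->
  forall x, a <= x <= b -> `|frac m a F x - frac m a G x| <= M * ((b - a) `^ m / m).
Proof.
move=> m0 cF cG FGM x /andP[ax xb].
have sub : `[a, x]%classic `<=` `[a, b] by exact: subset_itvl.
have cFx := continuous_subspaceW sub cF; have cGx := continuous_subspaceW sub cG.
have := @frac_linear _ m a x (-1) G F m0 ax cGx cFx.
rewrite mulN1r addrC => <-.
have cFG : {within `[a, x], continuous (fun t => -1 * G t + F t)}.
  move=> t; apply: cvgD; last exact: cFx.
  by apply: cvgMl_tmp; exact: cGx.
have FM t : a <= t <= x -> `|-1 * G t + F t| <= M.
  by move=> /andP[at_ tx]; rewrite mulN1r addrC FGM// at_ (le_trans tx).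
(* [M] is nonnegative because it bounds an absolute value at [a]. *)
apply: le_trans (le_frac m0 ax cFG FM) _; apply: ler_wpM2l.
  by apply: le_trans (FM a _); rewrite ?lexx.
by apply: le_powR_div; rewrite ?ax.
Qed.

(** When [F] is the primitive of an integrable [g], [frac m a F] is the primitive of [frac m a g],
    hence continuous. The general [F] is a uniform limit of such primitives, and a three-epsilon
    argument concludes. *)
Lemma frac_continuous m a b F : 0 < m -> a <= b ->
  {within `[a, b], continuous F} -> F a = 0 ->
  {within `[a, b], continuous (frac m a F)}.
Proof.
move=> m0 ab cF Fa; apply/subspace_continuousP => x xab.
apply/cvgrPdist_le => e e0.
pose K := (b - a) `^ m / m + 1.
have K0 : 0 < K by rewrite ltr_wpDl// divr_ge0 ?powR_ge0 ?ltW.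
have [g [cg gF]] := @antider_dense a b F ab cF Fa (e / 3 / K) ltac:(by rewrite !divr_gt0).
have gi y : mu.-integrable `[a, y] (EFin \o g).
  by apply: within_continuous_integrable; exact: continuous_subspaceT.
have close y : a <= y <= b -> `|frac m a F y - frac m a (antider a g) y| <= e / 3.
  move=> yab.
  have FgM t : a <= t <= b -> `|F t - antider a g t| <= e / 3 / K.
    by rewrite distrC; exact: gF.
  apply: le_trans (le_frac_sub m0 cF (antider_continuous ab (gi b)) FgM yab) _.
  rewrite -[leRHS](divfK (lt0r_neq0 K0)) ler_wpM2l ?lerDl//.
  by rewrite !divr_ge0// ltW.
have cG : {within `[a, b], continuous (fun y => frac m a (antider a g) y)}.
  have H y : y \in `[a, b]%classic -> antider a (frac m a g) y = frac m a (antider a g) y.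
    rewrite inE /= in_itv /= => /andP[ay _].
    by rewrite frac_antider//; have [_] := antider_frac m0 ay (gi y).
  apply: (subspace_eq_continuous H); apply: antider_continuous => //.
  by have [] := antider_frac m0 ab (gi b).
have /subspace_continuousP /(_ x xab) /cvgrPdist_le := cG.
have e3 : 0 < e / 3 by rewrite divr_gt0.
move=> /(_ _ e3); rewrite /= !near_withinE; apply: filterS => y H yab.
have h1 := H yab; have h2 := close x xab; have := close y yab; rewrite distrC => h3.
rewrite (le_trans (ler_distD (frac m a (antider a g) x) _ _))//.
rewrite (_ : e = e / 3 + (e / 3 + e / 3)); last by field.
apply: lerD h2 _.
apply: (le_trans (ler_distD (frac m a (antider a g) y) _ _)).
exact: lerD h1 h3.
Qed.

End density.

(** * The Alexiewicz norm *)

Section Alexiewicz.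
Variable R : realType.
Variables a b : R.
Hypothesis ab : a < b.
Implicit Types (f g : dist R) (F G : R -> R).
Local Notation mu := (@lebesgue_measure R).

Lemma is_prim_eq f F G : is_prim a b f F -> (forall x, a <= x <= b -> F x = G x) ->
  is_prim a b f G.
Proof.
move=> [cF Fa fF] FG; split.
- apply: (subspace_eq_continuous _ cF) => x.
  by rewrite inE /= in_itv /=; exact: FG.
- by rewrite -FG// lexx ltW.
- move=> phi tphi; rewrite fF//; congr (- _); apply: eq_Rintegral => t.
  by rewrite inE /= in_itv /= => /FG ->.
Qed.

Lemma primP f : DHK a b f -> is_prim a b f (prim a b f).
Proof. by move=> fH; exact: xgetPex. Qed.

Lemma is_prim_DHK f F : is_prim a b f F -> DHK a b f.
Proof. by exists F. Qed.

(** [prim] is a choice among primitives; uniqueness determines it on [[a, b]], and only there. *)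
Lemma primE f F : is_prim a b f F -> forall x, a <= x <= b -> prim a b f x = F x.
Proof. by move=> fF; exact: prim_unique (primP (is_prim_DHK fF)) fF. Qed.

Lemma alex_le f F M : is_prim a b f F -> (forall x, a <= x <= b -> `|F x| <= M) ->
  alex a b f <= M.
Proof.
move=> fF FM; apply: ge_sup.
  by exists `|prim a b f a|; exists a => //=; rewrite in_itv /= lexx ltW.
by move=> _ [x /= + <-]; rewrite in_itv /= => xab; rewrite (primE fF)// FM.
Qed.

Lemma le_alex f F x : is_prim a b f F -> a <= x <= b -> `|F x| <= alex a b f.
Proof.
move=> fF xab; apply: ub_le_sup; last first.
  by exists x; rewrite /= ?in_itv// (primE fF).
have [cF _ _] := fF; have [M FM] := within_continuous_bounded cF.
by exists M => _ [y /= + <-]; rewrite in_itv /= => yab; rewrite (primE fF)// FM.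
Qed.

Lemma is_prim_linear (c : R) f g F G : is_prim a b f F -> is_prim a b g G ->
  is_prim a b (dist_add (dist_scale c f) g) (fun x => c * F x + G x).
Proof.
move=> [cF Fa fF] [cG Ga gG]; split.
- move=> t; apply: cvgD; last exact: cG.
  by apply: cvgMl_tmp; exact: cF.
- by rewrite Fa Ga mulr0 addr0.
move=> phi tphi; have [_ cphi _] := test_fun_derive tphi.
rewrite /dist_add /dist_scale fF// gG// mulrN -opprD; congr (- _).
have iF := integrable_mul_continuous cF cphi.
have iG := integrable_mul_continuous cG cphi.
rewrite -RintegralZl// -RintegralD//; last exact: integrableZl iF.
by apply: eq_Rintegral => t _; rewrite mulrDl mulrA.
Qed.

Lemma is_prim_sub f g F G : is_prim a b f F -> is_prim a b g G ->
  is_prim a b (dist_sub f g) (fun x => F x - G x).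
Proof.
move=> fF gG; have := is_prim_linear (-1) gG fF.
have -> : dist_add (dist_scale (-1) g) f = dist_sub f g.
  by apply/funext => phi; rewrite /dist_add /dist_scale mulN1r addrC.
by move=> /is_prim_eq; apply => x _; rewrite mulN1r addrC.
Qed.

Lemma alex_ge0 f F : is_prim a b f F -> 0 <= alex a b f.
Proof.
move=> fF; have aab : a <= a <= b by rewrite lexx ltW.
exact: le_trans (normr_ge0 _) (le_alex fF aab).
Qed.

(** The difference of primitives is a primitive of the difference, so Alexiewicz convergence becomes
    uniform convergence of arbitrarily chosen primitives. *)
Lemma alex_toP (fs : nat -> dist R) f (Fs : nat -> R -> R) F :
  (forall k, is_prim a b (fs k) (Fs k)) -> is_prim a b f F ->
  alex_to a b fs f <-> forall e, 0 < e -> \forall k \near \oo,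
    forall x, a <= x <= b -> `|Fs k x - F x| <= e.
Proof.
move=> fsF fF; have pd k := is_prim_sub (fsF k) fF; split.
  move=> /cvgrPdist_le H e e0; apply: filterS (H e e0) => k + x xab.
  rewrite /= sub0r normrN ger0_norm ?(alex_ge0 (pd k))//.
  exact: le_trans (le_alex (pd k) xab).
move=> H; apply/cvgrPdist_le => e e0; apply: filterS (H e e0) => k He.
by rewrite /= sub0r normrN ger0_norm ?(alex_ge0 (pd k))// (alex_le (pd k)).
Qed.

Lemma is_prim_of_continuous F : {within `[a, b], continuous F} -> F a = 0 ->
  is_prim a b (fun phi => - \int[mu]_(x in `[a, b]) (F x * derive1 phi x)) F.
Proof. by []. Qed.

Lemma is_prim_regdist (g : R -> R) : isL1 a b g -> is_prim a b (regdist a b g) (antider a g).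
Proof.
move=> gi; split.
- by apply: antider_continuous => //; exact: ltW.
- by rewrite /antider set_itv1 Rintegral_set1.
move=> phi tphi; have [dphi cphi phib] := test_fun_derive tphi.
exact: antider_by_parts (ltW ab) gi dphi cphi phib.
Qed.

Lemma eq_regdist (g h : R -> R) : (forall x, a <= x <= b -> g x = h x) ->
  regdist a b g = regdist a b h.
Proof.
move=> gh; apply/funext => phi; apply: eq_Rintegral => x.
by rewrite inE /= in_itv /= => /gh ->.
Qed.

(** Density of [L^1] in [D_HK]. It ensures that the limit condition in [is_RLfrac] applies to at
    least one sequence, and so pins down the distribution selected by [RL]. *)
Lemma L1_approximation f : DHK a b f -> exists fk : nat -> R -> R,
  (forall k, isL1 a b (fk k)) /\ alex_to a b (fun k => regdist a b (fk k)) f.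
Proof.
move=> /primP fF; have [cF Fa _] := fF.
have H (k : nat) : exists g : R -> R, isL1 a b g /\
    forall x, a <= x <= b -> `|antider a g x - prim a b f x| <= k.+1%:R^-1.
  have [|g [cg gF]] := @antider_dense _ a b _ (ltW ab) cF Fa (k.+1%:R^-1).
    by rewrite invr_gt0.
  exists g; split=> //.
  by apply: within_continuous_integrable; exact: continuous_subspaceT.
have [fk fkP] := choice H; exists fk; split; first by move=> k; have [] := fkP k.
apply/(alex_toP (fun k => is_prim_regdist (proj1 (fkP k))) fF) => e e0.
have /cvgrPdist_le /(_ _ e0) := @cvg_harmonic R; apply: filterS => k ke x xab.
have [_ /(_ x xab) h] := fkP k; apply: le_trans h _.
by move: ke; rewrite sub0r normrN ger0_norm// invr_ge0.
Qed.

End Alexiewicz.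

(** * Riemann-Liouville integrals of distributions *)

Section RL.
Variable R : realType.
Variables a b n : R.
Hypothesis ab : a < b.
Implicit Types (f g : dist R) (F G : R -> R).
Local Notation mu := (@lebesgue_measure R).
Local Notation C := (GammaF n)^-1.

(** Both exchange identities combine: integrating [K_n g] and applying [K_n] to the primitive of [g]
    each give [K_(n+1) g / n]. *)
Lemma is_prim_RLconv (g : R -> R) : 0 < n -> isL1 a b g ->
  is_prim a b (regdist a b (RLconv a n g)) (fun x => C * frac n a (antider a g) x).
Proof.
move=> n0 gi; have [Ki _] := antider_frac n0 (ltW ab) gi.
have Ci : isL1 a b (RLconv a n g) by exact: integrableZl Ki.
apply: (is_prim_eq ab (is_prim_regdist ab Ci)) => x /andP[ax xb].
have gix : mu.-integrable `[a, x] (EFin \o g).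
  by apply: integrableS gi => //; exact: subset_itvl.
have [Kix Kx] := antider_frac n0 ax gix.
rewrite (frac_antider n0 ax gix) -Kx /antider -RintegralZl//.
Qed.

(** The boundary term carries [0^(n - 1) = 0], and the derivative of the kernel is
    [- (n - 1) (x - t)^(n - 2)]. *)
Lemma RLfun_gt1E f x : 1 < n -> {within `[a, b], continuous (prim a b f)} ->
  a <= x <= b -> RLfun a b n f x = C * ((n - 1) * frac (n - 1) a (prim a b f) x).
Proof.
move=> n1 cF /andP[ax xb]; rewrite /RLfun /hk_int_bv; congr (_ * _).
have m0 : 0 < n - 1 by rewrite subr_gt0.
have mN0 := lt0r_neq0 m0.
rewrite subrr powR0// mulr0 sub0r.
set F' := prim a b f.
have cFx : {within `[a, x], continuous F'}.
  by apply: continuous_subspaceW cF; exact: subset_itvl.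
have Ki := frac_integrable m0 ax cFx.
have KiN : mu.-integrable `[a, x]
    (EFin \o (fun t => - (n - 1) * ((x - t) `^ (n - 1 - 1) * F' t))).
  exact: integrableZl Ki.
have sub : `[a, x[%classic `<=` `[a, x]%classic .
  by move=> t; rewrite /= !in_itv /= => /andP[-> /ltW].
have DE t : t < x ->
    - (n - 1) * ((x - t) `^ (n - 1 - 1) * F' t) =
    F' t * derive1 (fun t => (x - t) `^ (n - 1)) t.
  move=> tx; rewrite [RHS]mulrC mulrA; congr (_ * _).
  have dz := is_deriveZ (- (n - 1)) (is_derive_powR_subr mN0 tx).
  have [_ dzE] := dz.
  rewrite derive1E; apply: etrans (esym dzE) _; congr (derive _ t 1).
  by apply/funext => u; rewrite /= /GRing.scale /=; field.
(* The formula for the derivative is known only for [t < x]; the endpoint, a null set, is removed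
   from both integrals. *)
have -> : \int[mu]_(t in `[a, x]) (F' t * derive1 (fun t => (x - t) `^ (n - 1)) t) =
    \int[mu]_(t in `[a, x]) (- (n - 1) * ((x - t) `^ (n - 1 - 1) * F' t)).
  rewrite -Rintegral_itv_bndo_bndc; last first.
    have KiNo : mu.-integrable `[a, x[
      (EFin \o (fun t => - (n - 1) * ((x - t) `^ (n - 1 - 1) * F' t))).
      exact: integrableS KiN.
    apply: eq_integrable KiNo => //.
    by move=> t; rewrite inE /= in_itv /= => /andP[_ tx]; rewrite /= DE.
  rewrite -Rintegral_itv_bndo_bndc; last exact: integrableS KiN.
  apply: eq_Rintegral => t; rewrite inE /= in_itv /= => /andP[_ tx].
  by rewrite DE.
by rewrite RintegralZl// mulNr opprK.
Qed.

Lemma frac1 F x : frac 1 a F x = antider a F x.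
Proof. by apply: eq_Rintegral => t _; rewrite subrr powRr0 mul1r. Qed.

(** Since [0^0 = 1], the kernel is constantly 1 up to [t = x]: the boundary term survives and the
    integral vanishes, the reverse of the case [n > 1]. *)
Lemma RLfun_eq1 f x : 1 = n -> RLfun a b n f x = C * prim a b f x.
Proof.
move=> <-; rewrite /RLfun /hk_int_bv !subrr powRr0.
have -> : (fun t => (x - t) `^ 0) = cst 1 by apply/funext => t; exact: powRr0.
rewrite (_ : Rintegral _ _ _ = 0) ?subr0 ?mulr1//.
rewrite -[RHS](mul0r (fine (mu `[a, x]))) -Rintegral_cst//.
by apply: eq_Rintegral => t _; rewrite derive1E derive_cst mulr0.
Qed.

(** For [n > 1] both functions are [C (n - 1) K_(n-1)] of a primitive, and the factor [n - 1]
    cancels the denominator in the bound for [K_(n-1)]. *)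
Lemma le_RLconv_RLfun f (g : R -> R) M : 1 <= n -> DHK a b f -> isL1 a b g ->
  (forall x, a <= x <= b -> `|antider a g x - prim a b f x| <= M) ->
  forall x, a <= x <= b -> `|RLconv a n g x - RLfun a b n f x| <=
    `|C| * (if n == 1 then 1 else (b - a) `^ (n - 1)) * M.
Proof.
move=> n1 fH gi gfM x xab; have /andP[ax xb] := xab.
have gix : mu.-integrable `[a, x] (EFin \o g).
  by apply: integrableS gi => //; exact: subset_itvl.
have [cF _ _] := primP fH.
move: n1; rewrite le_eqVlt => /predU1P[n1|n1].
  rewrite RLfun_eq1// /RLconv -n1 eqxx mulr1 -[X in _ * X - _]/(frac 1 a g x) frac1.
  by rewrite -mulrBr normrM ler_wpM2l// gfM.
have m0 : 0 < n - 1 by rewrite subr_gt0.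
have mN0 := lt0r_neq0 m0.
rewrite (RLfun_gt1E n1 cF xab) (gt_eqF n1).
have -> : RLconv a n g x = C * ((n - 1) * frac (n - 1) a (antider a g) x).
  by rewrite (frac_antider m0 ax gix) subrK (mulrC (n - 1)) divfK.
rewrite -!mulrBr !normrM -mulrA ler_wpM2l// (gtr0_norm m0).
apply: le_trans (ler_wpM2l (ltW m0)
  (le_frac_sub m0 (antider_continuous (ltW ab) gi) cF gfM xab)) _.
by rewrite mulrCA (mulrC (n - 1)) divfK// mulrC.
Qed.

Lemma is_prim_RLfun f : 1 <= n -> DHK a b f ->
  is_prim a b (regdist a b (RLfun a b n f)) (fun x => C * frac n a (prim a b f) x).
Proof.
move=> n1 fH; have fF := primP fH; have [cF Fa _] := fF.
have iF x : a <= x <= b -> mu.-integrable `[a, x] (EFin \o prim a b f).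
  move=> /andP[ax xb]; apply: within_continuous_integrable.
  by apply: continuous_subspaceW cF; exact: subset_itvl.
have aab : a <= b <= b by rewrite lexx ltW.
move: n1; rewrite le_eqVlt => /predU1P[n1|n1].
  rewrite (@eq_regdist _ _ _ _ (fun x => C * prim a b f x)); last first.
    by move=> x _; exact: RLfun_eq1.
  have iCF : isL1 a b (fun x => C * prim a b f x) by exact: integrableZl (iF b aab).
  apply: (is_prim_eq ab (is_prim_regdist ab iCF)) => x xab.
  by rewrite -n1 frac1 /antider RintegralZl ?iF.
have m0 : 0 < n - 1 by rewrite subr_gt0.
have [iK _] := antider_frac m0 (ltW ab) (iF b aab).
rewrite (eq_regdist (fun x => @RLfun_gt1E f x n1 cF)).
pose h x := C * ((n - 1) * frac (n - 1) a (prim a b f) x).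
have iCK : isL1 a b h by exact: integrableZl (integrableZl _ (n - 1) iK).
apply: (is_prim_eq ab (is_prim_regdist ab iCK)) => x xab.
have /andP[ax _] := xab.
have [iKx Kx] := antider_frac m0 ax (iF x xab).
rewrite /antider /h RintegralZl//; last exact: integrableZl iKx.
rewrite RintegralZl//; congr (_ * _).
move: Kx; rewrite /antider => ->; rewrite subrK.
by rewrite mulrCA divff ?mulr1// lt0r_neq0.
Qed.

(** Continuity of [K_n] for the uniform norm, read on primitives. It serves for the existence of the
    limit when [0 < n < 1], for (iii), and for the [D_HK] half of (iv). *)
Lemma frac_alex_to (fs hs : nat -> dist R) f h (Fs : nat -> R -> R) F : 0 < n ->
  (forall k, is_prim a b (fs k) (Fs k)) -> is_prim a b f F ->
  (forall k, is_prim a b (hs k) (fun x => C * frac n a (Fs k) x)) ->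
  is_prim a b h (fun x => C * frac n a F x) ->
  alex_to a b fs f -> alex_to a b hs h.
Proof.
move=> n0 fsF fF hsF hF /(alex_toP ab fsF fF) H; apply/(alex_toP ab hsF hF) => e e0.
(* The [+ 1] makes [L] positive even if [C] is 0. *)
pose L := `|C| * ((b - a) `^ n / n) + 1.
have L0 : 0 < L by rewrite ltr_wpDl// mulr_ge0// divr_ge0 ?powR_ge0 ?ltW.
apply: filterS (H _ (divr_gt0 e0 L0)) => k Hk x xab.
rewrite -mulrBr normrM.
have [cFk _ _] := fsF k; have [cF _ _] := fF.
apply: le_trans (ler_wpM2l (normr_ge0 _) (le_frac_sub n0 cFk cF Hk xab)) _.
rewrite mulrCA -[leRHS](divfK (lt0r_neq0 L0)) ler_wpM2l ?lerDl//.
by rewrite divr_ge0// ltW.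
Qed.

Lemma is_prim_frac F : 0 < n -> {within `[a, b], continuous F} -> F a = 0 ->
  is_prim a b (fun phi => - \int[mu]_(x in `[a, b]) (C * frac n a F x * derive1 phi x))
    (fun x => C * frac n a F x).
Proof.
move=> n0 cF Fa; apply: is_prim_of_continuous.
  move=> x; apply: cvgMl_tmp; exact: (frac_continuous n0 (ltW ab) cF Fa).
by rewrite /frac set_itv1 Rintegral_set1 mulr0.
Qed.

(** [RL] selects some distribution satisfying [is_RLfrac]; the derivative of [C K_n F] witnesses
    that one exists. *)
Lemma is_RLfrac_RL f : 0 < n < 1 -> DHK a b f -> is_RLfrac a b n f (RL a b n f).
Proof.
move=> /andP[n0 n1] fH; have fF := primP fH; have [cF Fa _] := fF.
rewrite /RL gt_eqF// n1; apply: xgetPex.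
have hF := is_prim_frac n0 cF Fa; eexists; split; first exact: is_prim_DHK hF.
move=> fk fkL fkf.
exact: (frac_alex_to n0 (fun k => is_prim_regdist ab (fkL k)) fF
  (fun k => is_prim_RLconv n0 (fkL k)) hF fkf).
Qed.

(** For [n < 1] the selected distribution is known only as a limit. Along one approximating [L^1]
    sequence the primitives converge uniformly both to its primitive and to [C K_n F], which
    therefore agree. *)
Lemma is_prim_RL f : 0 < n -> DHK a b f ->
  is_prim a b (RL a b n f) (fun x => C * frac n a (prim a b f) x).
Proof.
move=> n0 fH; have [n1|n1] := leP 1 n.
  by rewrite /RL gt_eqF// ltNge n1; exact: is_prim_RLfun.
have fF := primP fH; have [cF Fa _] := fF.
have [|gH fkg] := is_RLfrac_RL _ fH; first by rewrite n0.
have gG := primP gH; have hF := is_prim_frac n0 cF Fa.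
have [fk [fkL fkf]] := L1_approximation ab fH.
have fkF k := is_prim_RLconv n0 (fkL k).
have H1 := (alex_toP ab fkF gG).1 (fkg _ fkL fkf).
have H2 := (alex_toP ab fkF hF).1
  (frac_alex_to n0 (fun k => is_prim_regdist ab (fkL k)) fF fkF hF fkf).
apply: (is_prim_eq ab gG) => x xab; apply/eqP; rewrite -subr_eq0 -normr_le0.
apply/ler_addgt0Pl => e e0; rewrite addr0.
have e2 : 0 < e / 2 by rewrite divr_gt0.
have [k [k1 k2]] := @filter_ex _ _ _ _ (filterI (H1 _ e2) (H2 _ e2)).
apply: le_trans (ler_distD (C * frac n a (antider a (fk k)) x) _ _) _.
by rewrite [leRHS](splitr e) lerD// ?k2// distrC k1.
Qed.

End RL.

Theorem theorem3p3 (R : realType) (a b n : R) (hab : a < b) (hn : 0 <= n) :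
  (* (i) J_a^n maps D_HK into D_HK (for 0<n<1 the defining limit exists) *)
  (forall f, DHK a b f ->
     DHK a b (RL a b n f) /\ (0 < n < 1 -> is_RLfrac a b n f (RL a b n f))) /\
  (* (ii) linear ... *)
  (forall (c : R) f g, DHK a b f -> DHK a b g ->
     dist_eq a b (RL a b n (dist_add (dist_scale c f) g))
             (dist_add (dist_scale c (RL a b n f)) (RL a b n g))) /\
  (* ... and bounded for the Alexiewicz norm *)
  (exists M : R, 0 <= M /\
     forall f, DHK a b f -> alex a b (RL a b n f) <= M * alex a b f) /\
  (* (iii) continuity *)
  (forall (fk : nat -> dist R) (f : dist R),
     (forall k, DHK a b (fk k)) -> DHK a b f -> alex_to a b fk f ->
     alex_to a b (fun k => RL a b n (fk k)) (RL a b n f)) /\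
  (* (iv) n >= 1: approximation by L^1 functions, in D_HK and in C[a,b] *)
  (1 <= n -> forall (f : dist R) (fk : nat -> R -> R),
     DHK a b f -> (forall k, isL1 a b (fk k)) ->
     alex_to a b (fun k => regdist a b (fk k)) f ->
     alex_to a b (fun k => regdist a b (RLconv a n (fk k))) (RL a b n f) /\
     (forall e : R, 0 < e -> \forall k \near \oo,
        forall x, a <= x <= b -> `|RLconv a n (fk k) x - RLfun a b n f x| < e)).
Proof.
move: (hn); rewrite le_eqVlt => /predU1P[n0|n0]; last first.
- have RLprim (f : dist R) := @is_prim_RL R a b n hab f n0.
  split; [|split; [|split; [|split]]].
  + move=> f fH; split; first exact: is_prim_DHK (RLprim f fH).
    by move=> n01; exact: is_RLfrac_RL.
  + move=> c f g fH gH phi tphi.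
    have fF := primP fH; have gG := primP gH.
    have [cF _ _] := fF; have [cG _ _] := gG.
    have hH := is_prim_linear c fF gG.
    have RLh := RLprim _ (is_prim_DHK hH).
    have RLfg := is_prim_linear c (RLprim f fH) (RLprim g gH).
    (* Both sides of the linearity claim get the same primitive on [[a, b]], hence the same values
       on test functions. *)
    have E x : a <= x <= b ->
        (GammaF n)^-1 * frac n a (prim a b (dist_add (dist_scale c f) g)) x =
        c * ((GammaF n)^-1 * frac n a (prim a b f) x) +
        (GammaF n)^-1 * frac n a (prim a b g) x.
      move=> /andP[ax xb].
      have sub : `[a, x]%classic `<=` `[a, b] by exact: subset_itvl.
      rewrite (@eq_frac _ _ _ _ _ (fun t => c * prim a b f t + prim a b g t)).
        rewrite frac_linear//; [by ring|exact: continuous_subspaceW cF|].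
        exact: continuous_subspaceW cG.
      by move=> t /andP[at_ tx]; rewrite (primE hab hH)// at_ (le_trans tx).
    have [_ _ ->] := is_prim_eq hab RLh E => //.
    by have [_ _ ->] := RLfg.
  + exists (`|(GammaF n)^-1| * ((b - a) `^ n / n)).
    have M0 : 0 <= (b - a) `^ n / n by rewrite divr_ge0 ?powR_ge0.
    split; first by rewrite mulr_ge0.
    move=> f fH; have fF := primP fH; have [cF _ _] := fF.
    apply: (alex_le hab (RLprim f fH)) => x /andP[ax xb].
    rewrite normrM -mulrA ler_wpM2l// mulrC.
    have FM t : a <= t <= x -> `|prim a b f t| <= alex a b f.
      by move=> /andP[at_ tx]; apply: (le_alex hab fF); rewrite at_ (le_trans tx).
    have cFx : {within `[a, x], continuous prim a b f}.
      by apply: continuous_subspaceW cF; exact: subset_itvl.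
    apply: le_trans (le_frac n0 ax cFx FM) _.
    by rewrite ler_wpM2l ?(alex_ge0 hab fF)// le_powR_div// ax.
  + move=> fk f fkH fH; have fF := primP fH.
    exact: (frac_alex_to hab n0 (fun k => primP (fkH k)) fF
      (fun k => RLprim _ (fkH k)) (RLprim f fH)).
  + move=> n1 f fk fH fkL fkf; have fF := primP fH; have [cF _ _] := fF.
    have fkF k := is_prim_regdist hab (fkL k).
    split.
      exact: (frac_alex_to hab n0 fkF fF (fun k => is_prim_RLconv hab n0 (fkL k))
        (RLprim f fH) fkf).
    move=> e e0; have H := (alex_toP hab fkF fF).1 fkf.
    pose L := `|(GammaF n)^-1| * (if n == 1 then 1 else (b - a) `^ (n - 1)) + 1.
    have L0 : 0 < L.
      by rewrite ltr_wpDl// mulr_ge0//; case: ifP => // _; exact: powR_ge0.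
    (* The extra factor 1/2 turns the non-strict bounds into the strict inequality required. *)
    have eL0 : 0 < e / L / 2 by rewrite !divr_gt0.
    apply: filterS (H _ eL0) => k Hk x xab.
    apply: le_lt_trans (le_RLconv_RLfun hab n1 fH (fkL k) Hk xab) _.
    apply: (@le_lt_trans _ _ (L * (e / L / 2))).
      by rewrite ler_wpM2r ?lerDl// ltW.
    by rewrite mulrC mulrAC divfK ?lt0r_neq0//; lra.
- have RLE f : RL a b n f = f by rewrite /RL -n0 eqxx.
  split; [|split; [|split; [|split]]].
  + by move=> f fH; rewrite RLE -n0 ltxx.
  + by move=> c f g _ _ phi _; rewrite !RLE.
  + by exists 1; split=> // f _; rewrite RLE mul1r.
  + by move=> fk f _ _; rewrite RLE (_ : (fun k => RL a b n (fk k)) = fk)//;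
      apply/funext => k; exact: RLE.
  + by rewrite -n0 ler10.
Qed.
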